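(* Let $\theta:\mathbb{R}_+\to\mathbb{R}_+$ be a monotone non-decreasing function such that $$\lim_{r\to 0+}\theta(r)=0\quad\text{and}\quad \int_0^{*}\frac{\theta(r)}{r}\,dr=+\infty .$$ Then there exist a $C^1$ function $\varphi:\mathbb{R}\to\mathbb{R}$ and a $C^1$ domain $$D:=\{(x,t)\in\mathbb{R}\times\mathbb{R}:\ x\in\mathbb{R},\ t>\varphi(x)\}$$ such that the following holds: (i) there exists a bounded set $S\subset\mathbb{R}$ containing infinitely (countably) many points, such that for each $x_0\in S$ the modulus of continuity of $\nabla\varphi$ at $x_0$, denoted by $\alpha(r)$, satisfies $$\theta(r)\le\alpha(r)\le\theta(4r);$$ (ii) $\varphi\in C^2(\mathbb{R}\setminus\overline{S})$; (iii) letting $\omega$ denote the harmonic measure in $D$, $$\left\{p\in\partial D:\ \liminf_{r\to 0}\frac{\omega(\Delta_r(p))}{r}=\limsup_{r\to 0}\frac{\omega(\Delta_r(p))}{r}=0\right\}\supset \{(x,\varphi(x)):\ x\in S\}.$$ In particular, the set $$\left\{p\in\partial D:\ \liminf_{r\to 0}\frac{\omega(\Delta_r(p))}{r}=\limsup_{r\to 0}\frac{\omega(\Delta_r(p))}{r}=0\right\}$$ is infinite.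
   Context: $\mathbb{R}_+=(0,\infty)$. The notation $\int_0^{*}\frac{\theta(r)}{r}\,dr=+\infty$ means that the integral diverges at $0$, i.e. $\int_0^{\delta}\frac{\theta(r)}{r}\,dr=+\infty$ for every (small) $\delta>0$. Here $\nabla\varphi=\varphi'$, and the modulus of continuity of a function $h:\mathbb{R}\to\mathbb{R}$ at a point $x_0$ is the function $r\mapsto\sup_{|x-x_0|\le r}|h(x)-h(x_0)|$. For $p\in\partial D$ and $r>0$, $\Delta_r(p):=\partial D\cap B_r(p)$ is the surface ball, where $B_r(p)$ is the ball of radius $r$ centered at $p$. The measure $\omega$ is the harmonic measure of $D$ for the Laplacian, with an arbitrary fixed pole $X\in D$. *)

(* Defs.v *)
From HB Require Import structures.
From mathcomp Require Import all_boot all_order all_algebra.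
From mathcomp Require Import all_classical all_reals all_analysis.
Import Order.TTheory GRing.Theory Num.Theory.
Import numFieldNormedType.Exports.

Set Implicit Arguments.
Unset Strict Implicit.
Unset Printing Implicit Defensive.

Local Open Scope classical_set_scope.
Local Open Scope ring_scope.

Section functions_of_one_variable.
Context {R : realType}.
Implicit Types (f h theta : R -> R) (U : set R) (x r : R).

Definition C1 f := (forall x, derivable f x 1) /\ continuous (derive1 f).

(* For [U] open; the continuity of [f] and of its first derivative follow. *)
Definition C2_on f U :=
  forall x, U x -> [/\ derivable f x 1, derivable (derive1 f) x 1
                     & {for x, continuous (derive1 (derive1 f))}].

(* The real-valued [sup] is the true supremum only for nonempty bounded sets,
   which is the case here when [h] is continuous and [0 <= r]. *)
Definition modulus h x0 r : R :=
  sup [set `|h x - h x0| | x in [set x | `|x - x0| <= r]].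

Definition integral_diverges_at0 theta :=
  forall delta, 0 < delta ->
    (\int[lebesgue_measure]_(r in `]0%R, delta[) (theta r / r)%:E = +oo)%E.

Definition epigraph f : set (R * R) := [set p | f p.1 < p.2].

End functions_of_one_variable.

Section harmonic_measure.
Context {R : realType}.
Implicit Types (D : set (R * R)) (p X : R * R) (r : R).

(* The library metric on [R * R] is the sup metric; these are Euclidean
   discs. The two topologies agree. *)
Definition disc p r : set (R * R) :=
  [set q | Num.sqrt ((q.1 - p.1) ^+ 2 + (q.2 - p.2) ^+ 2) < r].

Definition closed_disc p r : set (R * R) :=
  [set q | Num.sqrt ((q.1 - p.1) ^+ 2 + (q.2 - p.2) ^+ 2) <= r].

Definition boundary D : set (R * R) := closure D `\` interior D.

Definition surface_ball D p r : set (R * R) := boundary D `&` disc p r.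

Definition circle_mean (u : R * R -> \bar R) p r : \bar R :=
  (((2 * pi)^-1)%:E *
   \int[lebesgue_measure]_(t in `[0%R, (2 * pi)%R])
      u (p.1 + r * cos t, p.2 + r * sin t)%R)%E.

(* For [D] open: [-oo] is allowed as a value, including identically. *)
Definition subharmonic D (u : R * R -> \bar R) :=
  [/\ forall p, D p -> (u p < +oo)%E,
      forall p (a : R), D p -> (u p < a%:E)%E ->
        \forall q \near p, (u q < a%:E)%E
    & forall p r, 0 < r -> closed_disc p r `<=` D ->
        (u p <= circle_mean u p r)%E].

(* Members are bounded above on [D], so that for an unbounded [D] no condition
   is needed at infinity (extended maximum principle). *)
Definition perron_family D (f : R * R -> R) : set (R * R -> \bar R) :=
  [set u | [/\ subharmonic D u,
      exists M : R, forall p, D p -> (u p <= M%:E)%E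
    & forall p, boundary D p ->
        (limf_esup u (within D (nbhs p)) <= (f p)%:E)%E]].

Definition perron_solution D (f : R * R -> R) X : \bar R :=
  ereal_sup [set u X | u in perron_family D f].

(* The functions in C_c(boundary D); values off the boundary are irrelevant. *)
Definition boundary_data D (f : R * R -> R) :=
  {within boundary D, continuous f} /\
  exists2 K : set (R * R), compact K & forall p, (boundary D `\` K) p -> f p = 0.

(* [omega] is the harmonic measure of [D] for the Laplacian with pole [X]: the
   Borel probability measure carried by the boundary that represents the
   solution at [X] of the Dirichlet problem. *)
Definition is_harmonic_measure D X
    (omega : probability (measurableTypeR R * measurableTypeR R)%type R) :=
  omega (~` boundary D) = 0%E /\
  forall f, boundary_data D f ->
    (\int[omega]_(p in boundary D) (f p)%:E = perron_solution D f X)%E.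

Definition density_ratio D
    (omega : probability (measurableTypeR R * measurableTypeR R)%type R)
    p r : \bar R :=
  (omega (surface_ball D p r) * (r^-1)%:E)%E.

Definition zero_density_set D
    (omega : probability (measurableTypeR R * measurableTypeR R)%type R) :
    set (R * R) :=
  [set p | [/\ boundary D p,
      limf_einf (density_ratio D omega p) 0^'+ = 0%E
    & limf_esup (density_ratio D omega p) 0^'+ = 0%E]].

End harmonic_measure.

(* Main.v *)
Require Import Defs.
From HB Require Import structures.
From mathcomp Require Import all_boot all_order all_algebra.
From mathcomp Require Import all_classical all_reals all_analysis.
From mathcomp Require Import measurable_realfun zify ring lra.
Import Order.TTheory GRing.Theory Num.Theory.
Import numFieldNormedType.Exports.

Local Open Scope classical_set_scope.
Local Open Scope ring_scope.

(** Put [S = {16^-k}] and [phi = Phi o tau], where [Phi' = g] is a smooth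
function with [theta (2 r) <= g r <= theta (4 r)] and [tau] is the distance to
the closure of [S], rounded off near the midpoints of the gaps. Then [phi >= 0]
vanishes on [S], so the domain lies above the tangent at each [p] in [S], while
[phi (p + s) >= s theta(s) / 2] for small [s > 0].

Let [P] be the Poisson kernel of the half plane with pole [p]. A subsolution
[u <= A P] outside the disc of radius [R] vanishes on the graph over
[[p + 2R, p + 4R]], where [P >= c theta(R) / R]; comparing [A P - u] with a
multiple of the harmonic measure of that segment improves the bound to
[u <= A (1 - c theta(R)) P] outside the disc of radius [64 R]. Iterating over
the scales [64^i r] gives [omega(Delta_r(p)) <= C r exp(- c sum_i theta(64^i r))],
and the sum diverges as [r] tends to [0] by the failure of the Dini condition. *)

(** * Second-order expansions *)

(** On a flat boundary nothing would be gained: [P] vanishes on the segment, and no positive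
    multiple of its view angle [T] stays below [P]. Near the segment the lift of the graph bounds
    [P] below by a multiple of [theta R / R], while [T < pi]; elsewhere outside the disc
    [T <= 8 R P]. So [P - k T >= 0] with [k] of order [theta R / R]. This subtraction must not spoil
    the bound on the inner circle. There [T <= R P], whereas [T] behaves like [2 R P] at infinity,
    the segment having length [2 R]; the difference of the two factors is the gain of a step, and at
    the ratio [64] of the scales it is still [3 / 2] against [1].

    Members of the Perron family are known only through an upper bound, semicontinuity and circle
    means, so all comparison functions are explicit and their Laplacians are read off second-order
    expansions.

    [theta] may jump; the dilates [2] and [4] leave the room for a smooth [g]. The lower dilate [2]
    also absorbs the losses of distance in [Phi_lower] and, for large [r], in [modulus_phi]. *)

Section jets.
Context {R : realType}.
Implicit Types (e f g : R -> R -> R) (h k : R * R -> R) (p q : R * R).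

(** The class of functions of order [n] at the origin. The radius [d] is kept at most [1] so that
    exponents can be lowered in [ordW]. *)
Definition ord (n : nat) (e : R -> R -> R) : Prop :=
  exists C d : R, [/\ 0 <= C, 0 < d, d <= 1 &
    forall a b, `|a| + `|b| <= d -> `|e a b| <= C * (`|a| + `|b|) ^+ n].

Lemma ord_eq n e f : (forall a b, e a b = f a b) -> ord n e -> ord n f.
Proof. by move=> ef [C [d [? ? ? H]]]; exists C, d; split => // a b; rewrite -ef; exact: H. Qed.

Lemma ordD n e f : ord n e -> ord n f -> ord n (fun a b => e a b + f a b).
Proof.
move=> [C [d [C0 d0 d1 H]]] [C' [d' [C0' d0' d1' H']]].
exists (C + C'), (Num.min d d'); split.
- exact: addr_ge0.
- by rewrite lt_min d0.
- by rewrite ge_min d1.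
- move=> a b; rewrite le_min => /andP[/H h1 /H' h2].
  by rewrite mulrDl (le_trans (ler_normD _ _))// lerD.
Qed.

Lemma ordM m n e f : ord m e -> ord n f ->
  ord (m + n) (fun a b => e a b * f a b).
Proof.
move=> [C [d [C0 d0 d1 H]]] [C' [d' [C0' d0' d1' H']]].
exists (C * C'), (Num.min d d'); split.
- exact: mulr_ge0.
- by rewrite lt_min d0.
- by rewrite ge_min d1.
- move=> a b; rewrite le_min => /andP[/H h1 /H' h2].
  by rewrite normrM exprD mulrACA ler_pM.
Qed.

Lemma ordW m n e : (m <= n)%N -> ord n e -> ord m e.
Proof.
move=> mn [C [d [C0 d0 d1 H]]]; exists C, d; split => // a b ab.
apply: (le_trans (H _ _ ab)); rewrite ler_wpM2l//.
by rewrite ler_wiXn2l ?addr_ge0// (le_trans ab).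
Qed.

Lemma ord_cst c : ord 0 (fun _ _ => c).
Proof.
by exists `|c|, 1; split => // a b _; rewrite expr0 mulr1.
Qed.

Lemma ord_fst : ord 1 (fun a _ => a).
Proof. by exists 1, 1; split => // a b _; rewrite mul1r expr1 lerDl. Qed.

Lemma ord_snd : ord 1 (fun _ b => b).
Proof. by exists 1, 1; split => // a b _; rewrite mul1r expr1 lerDr. Qed.

Lemma ordZ n c e : ord n e -> ord n (fun a b => c * e a b).
Proof. by move=> oe; rewrite -[n]add0n; apply: ordM => //; exact: ord_cst. Qed.

Lemma ord0 n : ord n (fun _ _ => 0).
Proof. by exists 0, 1; split => // a b _; rewrite normr0 mul0r. Qed.

Definition quad (A B al be ga : R) (a b : R) : R :=
  A * a + B * b + (al * a ^+ 2 + be * (a * b) + ga * b ^+ 2).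

(* [quad] holds the Taylor coefficients, not the derivatives: the Laplacian of
   [h] at [p] is [2 * (al + ga)]. *)
Definition jet h p (A B al be ga : R) : Prop :=
  ord 3 (fun a b => h (p.1 + a, p.2 + b) - (h p + quad A B al be ga a b)).

Lemma ord_lin A B : ord 1 (fun a b => A * a + B * b).
Proof. by apply: ordD; apply: ordZ; [exact: ord_fst|exact: ord_snd]. Qed.

Lemma ord_quad2 al be ga :
  ord 2 (fun a b => al * a ^+ 2 + be * (a * b) + ga * b ^+ 2).
Proof.
apply: ordD; first apply: ordD; apply: ordZ.
- by apply: (@ord_eq _ (fun a b => a * a)) => [a b|]; [rewrite expr2|
    apply: (@ordM 1 1); exact: ord_fst].
- by apply: (@ordM 1 1); [exact: ord_fst|exact: ord_snd].
- by apply: (@ord_eq _ (fun a b => b * b)) => [a b|]; [rewrite expr2|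
    apply: (@ordM 1 1); exact: ord_snd].
Qed.

Lemma jet_ord2 h p A B al be ga : jet h p A B al be ga ->
  ord 2 (fun a b => h (p.1 + a, p.2 + b) - h p - (A * a + B * b)).
Proof.
move=> /(@ordW 2 3 _ isT) j.
apply: ord_eq (ordD _ _ _ j (ord_quad2 al be ga)) => a b.
by rewrite /quad; ring.
Qed.
#[global] Arguments jet_ord2 {h p A B al be ga}.

Lemma jet_ord1 h p A B al be ga : jet h p A B al be ga ->
  ord 1 (fun a b => h (p.1 + a, p.2 + b) - h p).
Proof.
move=> /jet_ord2/(@ordW 1 2 _ isT) j.
by apply: ord_eq (ordD _ _ _ j (ord_lin A B)) => a b; ring.
Qed.
#[global] Arguments jet_ord1 {h p A B al be ga}.

Lemma jet_continuous h p A B al be ga : jet h p A B al be ga ->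
  {for p, continuous h}.
Proof.
move=> /jet_ord1[C [d [C0 d0 d1 H]]]; apply/cvgrPdist_lt => /= eps eps0.
pose r := Num.min (d / 2) (eps / (2 * (C + 1))).
have C1 : 0 < C + 1 by lra.
have r0 : 0 < r by rewrite /r lt_min !divr_gt0// mulr_gt0.
near=> q.
have [q1 q2] : ball p r q by near: q; apply: (@nbhsx_ballx R _ p r).
have {}q1 : `|q.1 - p.1| < r by rewrite distrC; exact: q1.
have {}q2 : `|q.2 - p.2| < r by rewrite distrC; exact: q2.
have qd : `|q.1 - p.1| + `|q.2 - p.2| <= 2 * r by lra.
have := H (q.1 - p.1) (q.2 - p.2); rewrite !subrKC expr1.
have rd : r <= d / 2 by rewrite /r ge_min lexx.
have re : r <= eps / (2 * (C + 1)) by rewrite /r ge_min lexx orbT.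
rewrite ler_pdivlMr ?mulr_gt0// in re.
move=> /(_ ltac:(lra)); rewrite -surjective_pairing distrC => h1.
apply: (le_lt_trans h1); apply: (@le_lt_trans _ _ (C * (2 * r))).
  by rewrite ler_wpM2l.
nra.
Unshelve. all: by end_near. Qed.
#[global] Arguments jet_continuous {h p A B al be ga}.

Lemma jet_cst c p : jet (fun=> c) p 0 0 0 0 0.
Proof. by apply: ord_eq (ord0 3) => a b; rewrite /quad; ring. Qed.

Lemma jet_fst p : jet fst p 1 0 0 0 0.
Proof. by apply: ord_eq (ord0 3) => a b; rewrite /quad/=; ring. Qed.

Lemma jet_snd p : jet snd p 0 1 0 0 0.
Proof. by apply: ord_eq (ord0 3) => a b; rewrite /quad/=; ring. Qed.

Lemma jetD h k p A B al be ga A' B' al' be' ga' :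
  jet h p A B al be ga -> jet k p A' B' al' be' ga' ->
  jet (fun q => h q + k q) p (A + A') (B + B') (al + al') (be + be') (ga + ga').
Proof.
by move=> H K; apply: ord_eq (ordD _ _ _ H K) => a b; rewrite /quad/=; ring.
Qed.
#[global] Arguments jetD {h k p A B al be ga A' B' al' be' ga'}.

Lemma jetZ c h p A B al be ga : jet h p A B al be ga ->
  jet (fun q => c * h q) p (c * A) (c * B) (c * al) (c * be) (c * ga).
Proof.
by move=> H; apply: ord_eq (ordZ _ c _ H) => a b; rewrite /quad/=; ring.
Qed.
#[global] Arguments jetZ c {h p A B al be ga}.

Lemma jetM h k p A B al be ga A' B' al' be' ga' :
  jet h p A B al be ga -> jet k p A' B' al' be' ga' ->
  jet (fun q => h q * k q) p (A * k p + h p * A') (B * k p + h p * B')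
    (al * k p + A * A' + h p * al') (be * k p + (A * B' + B * A') + h p * be')
    (ga * k p + B * B' + h p * ga').
Proof.
move=> H K.
have H1 := jet_ord1 H; have K2 := jet_ord2 K.
have H2 := jet_ord2 H.
(* With increments [dh], [dk] and their linear parts [Lh], [Lk], one has [dh * dk - Lh * Lk = dh *
   (dk - Lk) + (dh - Lh) * Lk], and both products are of order 3. *)
apply: ord_eq (ordD _ _ _ (ordD _ _ _ (ordZ _ (k p) _ H) (ordZ _ (h p) _ K))
  (ordD _ _ _ (ordM 1 2 _ _ H1 K2) (ordM 2 1 _ _ H2 (ord_lin A' B')))) => a b.
by rewrite /quad/=; ring.
Qed.
#[global] Arguments jetM {h k p A B al be ga A' B' al' be' ga'}.

Definition jet1 (F : R -> R) (w F1 F2 : R) : Prop :=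
  exists C d : R, [/\ 0 <= C, 0 < d & forall s, `|s| <= d ->
    `|F (w + s) - (F w + F1 * s + F2 * s ^+ 2)| <= C * `|s| ^+ 3].

Lemma jet_comp F h p F1 F2 A B al be ga : jet1 F (h p) F1 F2 ->
  jet h p A B al be ga ->
  jet (fun q => F (h q)) p (F1 * A) (F1 * B) (F1 * al + F2 * A ^+ 2)
    (F1 * be + F2 * (2 * (A * B))) (F1 * ga + F2 * B ^+ 2).
Proof.
move=> [C [d [C0 d0 HF]]] H.
have H1 := jet_ord1 H; have H2 := jet_ord2 H.
have HR : ord 3 (fun a b => let s := h (p.1 + a, p.2 + b) - h p in
    F (h (p.1 + a, p.2 + b)) - (F (h p) + F1 * s + F2 * s ^+ 2)).
  have [C' [d' [C'0 d'0 d'1 H']]] := H1.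
  have c1 : 0 < C' + 1 by lra.
  exists (C * C' ^+ 3), (Num.min d' (d / (C' + 1))); split.
  - by rewrite mulr_ge0 ?exprn_ge0.
  - by rewrite lt_min d'0 divr_gt0.
  - by rewrite ge_min d'1.
  - move=> a b; rewrite le_min => /andP[/H' h1]; rewrite ler_pdivlMr// => h2.
    rewrite expr1 in h1; have n0 : 0 <= `|a| + `|b| by rewrite addr_ge0.
    have sd : `|h (p.1 + a, p.2 + b) - h p| <= d by nra.
    have := HF _ sd; rewrite subrKC => /le_trans; apply.
    rewrite -mulrA ler_wpM2l// -exprMn lerXn2r// ?nnegrE//.
    exact: mulr_ge0.
(* With [s] the increment of [h] and [L] its linear part, [s ^+ 2 - L ^+ 2 = (s - L) * (s + L)] is
   of order [2 + 1]. *)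
have HS := ordM 2 1 _ _ H2
  (ordD _ _ _ H1 (ord_lin A B)).
apply: ord_eq (ordD _ _ _ (ordD _ _ _ HR (ordZ _ F1 _ H)) (ordZ _ F2 _ HS)) => a b.
by rewrite /quad/=; ring.
Qed.
#[global] Arguments jet_comp {F h p F1 F2 A B al be ga}.

Lemma jet_eq h k p A B al be ga : (forall q, h q = k q) ->
  jet h p A B al be ga -> jet k p A B al be ga.
Proof. by move=> /funext ->. Qed.

(** The remainder of [F] vanishes at [0] and its derivative is the first-order remainder of [dF];
    the mean value theorem turns the quadratic bound on the latter into a cubic one. *)
Lemma jet1_derive (F dF : R -> R) (w F1 F2 C d : R) : 0 < d -> 0 <= C ->
  (forall s, `|s| <= d -> is_derive (w + s) 1 F (dF (w + s))) ->
  (forall s, `|s| <= d -> `|dF (w + s) - F1 - 2 * F2 * s| <= C * s ^+ 2) ->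
  jet1 F w F1 F2.
Proof.
move=> d0 C0 dFP bnd.
exists C, d; split => // s sd.
pose G x := F (w + x) - (F w + F1 * x + F2 * x ^+ 2).
pose dG x := dF (w + x) - F1 - 2 * F2 * x.
have dGP (x : R) : `|x| <= d -> is_derive x 1 G (dG x).
  move=> /dFP dF'; rewrite /G /dG.
  have dS : is_derive x 1 (fun x => F (w + x)) (dF (w + x)).
    rewrite -[dF _]mulr1; apply: (@is_derive1_comp _ F (fun x => w + x)).
    rewrite -[1 in X in is_derive _ _ _ X]add0r; exact: is_deriveD.
  apply: is_derive_eq; rewrite /GRing.scale/=; ring.
have G0 : G 0 = 0 by rewrite /G; rewrite addr0; ring.
have cG (a b : R) : (forall x, x \in `[a, b] -> `|x| <= d) -> {within `[a, b], continuous G}.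
  move=> ab; apply: derivable_within_continuous => x /ab/dGP H.
  exact: ex_derive.
have key x : `|x| <= `|s| -> `|dG x| * `|s| <= C * `|s| ^+ 3.
  move=> xs; rewrite exprSr mulrA ler_wpM2r//.
  apply: (le_trans (bnd _ (le_trans xs sd))); rewrite ler_wpM2l//.
  by rewrite -(real_normK (num_real x)) lerXn2r// ?nnegrE.
rewrite -/(G s).
have [s0|s0|->] := ltrgtP s 0; last by rewrite G0 normr0 mulr_ge0.
- have /MVT : forall x : R, x \in `]s, 0[ -> is_derive x 1 G (dG x).
    by move=> x /[!in_itv]/= /andP[x1 x2]; apply: dGP; rewrite ler0_norm ?ltW//; rewrite ltr0_norm// in sd; lra.
  move=> /(_ s0)[|c /[!in_itv]/= /andP[c1 c2]].
    by apply: cG => x /[!in_itv]/= /andP[x1 x2]; rewrite ler0_norm//; rewrite ltr0_norm// in sd; lra.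
  rewrite G0 !sub0r => /eqP; rewrite eqr_oppLR => /eqP ->.
  rewrite mulrN opprK normrM; apply: key.
  by rewrite !ltr0_norm//; lra.
- have /MVT : forall x : R, x \in `]0, s[ -> is_derive x 1 G (dG x).
    by move=> x /[!in_itv]/= /andP[x1 x2]; apply: dGP; rewrite ger0_norm ?ltW//; rewrite gtr0_norm// in sd; lra.
  move=> /(_ s0)[|c /[!in_itv]/= /andP[c1 c2]].
    by apply: cG => x /[!in_itv]/= /andP[x1 x2]; rewrite ger0_norm//; rewrite gtr0_norm// in sd; lra.
  rewrite G0 !subr0 => ->; rewrite normrM; apply: key.
  by rewrite !gtr0_norm//; lra.
Qed.

Lemma jet1_inv (w : R) : w != 0 -> jet1 (@GRing.inv R) w (- w ^- 2) (w ^- 3).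
Proof.
move=> w0; have w1 : 0 < `|w| by rewrite normr_gt0.
exists (2 * `|w| ^- 4), (`|w| / 2); split.
- by rewrite mulr_ge0// invr_ge0 exprn_ge0.
- by rewrite divr_gt0.
- move=> s sd.
  have ws : `|w| / 2 <= `|w + s|.
    have := lerB_dist w (- s); rewrite normrN opprK; lra.
  have ws0 : w + s != 0 by rewrite -normr_gt0; lra.
  rewrite (_ : _ - _ = - s ^+ 3 / (w ^+ 3 * (w + s))); last first.
    by field; rewrite ws0.
  rewrite normf_div normrN normrX (normrM (w ^+ 3)) normrX mulrC ler_wpM2r// ?exprn_ge0//.
  rewrite -[leRHS]invrK lef_pV2 ?posrE; last 2 first.
  - by rewrite mulr_gt0 ?exprn_gt0//; lra.
  - by rewrite invr_gt0 mulr_gt0// invr_gt0 exprn_gt0.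
  rewrite invfM invrK [in leLHS]exprSr mulrCA ler_wpM2l// ?exprn_ge0//.
  lra.
Qed.

Lemma jet1_ln (w : R) : 0 < w -> jet1 (@ln R) w w^-1 (- (2 * w ^+ 2)^-1).
Proof.
move=> w0; apply: (@jet1_derive _ (@GRing.inv R) _ _ _ (2 * w ^- 3) (w / 2)).
- by rewrite divr_gt0.
- by rewrite mulr_ge0// invr_ge0 exprn_ge0// ltW.
- by move=> s; rewrite ler_norml => /andP[s1 s2]; apply: is_derive1_ln; lra.
- move=> s; rewrite ler_norml => /andP[s1 s2].
  have ws : w / 2 <= w + s by lra.
  have ws0 : 0 < w + s by lra.
  rewrite (_ : _ - _ = s ^+ 2 * (w ^+ 2 * (w + s))^-1); last first.
    by field; rewrite !gt_eqF.
  rewrite normrM ger0_norm ?sqr_ge0// mulrC ler_wpM2r ?sqr_ge0//.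
  rewrite ger0_norm; last by rewrite invr_ge0 mulr_ge0 ?sqr_ge0// ltW.
  rewrite -[leRHS]invrK lef_pV2 ?posrE; last 2 first.
  - by rewrite mulr_gt0 ?exprn_gt0.
  - by rewrite invr_gt0 mulr_gt0// invr_gt0 exprn_gt0.
  rewrite invfM invrK [in leLHS]exprSr mulrCA ler_wpM2l ?exprn_ge0 ?(ltW w0)//.
  lra.
Qed.

Lemma jet1_atan (w : R) :
  jet1 (@atan R) w (1 + w ^+ 2)^-1 (- w / (1 + w ^+ 2) ^+ 2).
Proof.
pose q := 1 + w ^+ 2; have q1 : 1 <= q by rewrite lerDl sqr_ge0.
have K0 : 0 <= q + 4 * w ^+ 2 + 2 * `|w|.
  have := sqr_ge0 w; have := normr_ge0 w; lra.
apply: (@jet1_derive _ (fun x => (1 + x ^+ 2)^-1) _ _ _ (q + 4 * w ^+ 2 + 2 * `|w|) 1) => //.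
- move=> s s1.
  have q'1 : 1 <= 1 + (w + s) ^+ 2 by rewrite lerDl sqr_ge0.
  rewrite -/q (_ : _ - _ =
     s ^+ 2 * ((- q + 4 * w ^+ 2 + 2 * w * s) / (q ^+ 2 * (1 + (w + s) ^+ 2)))); last first.
    by rewrite /q; field; rewrite -/q !gt_eqF//; lra.
  rewrite normrM ger0_norm ?sqr_ge0// mulrC ler_wpM2r ?sqr_ge0//.
  rewrite normrM normfV ler_pdivrMr ?normr_gt0 ?mulf_neq0 ?expf_neq0 ?gt_eqF//; try lra.
  set K := q + _ + _ in K0 *.
  have m1 : 1 <= `|q ^+ 2 * (1 + (w + s) ^+ 2)|.
    by rewrite ger0_norm ?mulr_ege1 ?exprn_ege1// mulr_ge0 ?sqr_ge0//; lra.
  apply: (@le_trans _ _ K); last by rewrite ler_peMr.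
  apply: (le_trans (ler_normD _ _)); apply: lerD.
    apply: (le_trans (ler_normD _ _)); rewrite normrN !ger0_norm//; try lra.
    by rewrite mulr_ge0 ?sqr_ge0.
  by rewrite !normrM (ger0_norm (_ : 0 <= 2))// ler_piMr// mulr_ge0.
Qed.

End jets.

(** * Maximum principle *)

Section integral_monotone.
Context d (T : measurableType d) (R : realType) (mu : {measure set T -> \bar R}).
Local Open Scope ereal_scope.

(* Unlike [ge0_le_integral] and [le_integral], no measurability is assumed. *)
Lemma ge0_le_integral_nomeas (D : set T) (f g : T -> \bar R) :
  (forall x, D x -> 0 <= f x) -> (forall x, D x -> f x <= g x) ->
  \int[mu]_(x in D) f x <= \int[mu]_(x in D) g x.
Proof.
move=> f0 fg; have g0 x : D x -> 0 <= g x.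
  by move=> Dx; apply: le_trans (f0 _ Dx) (fg _ Dx).
rewrite !ge0_integralE//; apply: ereal_sup_le => _ /= [h hf <-].
exists h => // x; apply: (le_trans (hf x)).
by rewrite /patch; case: ifPn => // /[!inE] /fg.
Qed.

Lemma le_integral_nomeas (D : set T) (f g : T -> \bar R) :
  (forall x, D x -> f x <= g x) ->
  \int[mu]_(x in D) f x <= \int[mu]_(x in D) g x.
Proof.
move=> fg; rewrite integralE [leRHS]integralE; apply: leeB.
- apply: ge0_le_integral_nomeas => x Dx; first exact: funepos_ge0.
  by rewrite !funeposE ge_max le_max fg//= le_max lexx orbT.
- apply: ge0_le_integral_nomeas => x Dx; first exact: funeneg_ge0.
  by rewrite !funenegE ge_max le_max leeN2 fg//= le_max lexx orbT.
Qed.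

End integral_monotone.

Section maximum_principle.
Context {R : realType}.
Implicit Types (h : R * R -> R) (u : R * R -> \bar R) (p q : R * R).

(** Over a full turn the linear and mixed terms cancel and each square has mean [1 / 2], so the mean
    of a quadratic polynomial exceeds its central value by a quarter of the Laplacian. *)
Lemma integral_trig_quadratic (c A B al be ga : R) :
  (\int[lebesgue_measure]_(t in `[0%R, (2 * pi)%R])
    (c + A * cos t + B * sin t +
      (al * cos t ^+ 2 + be * (cos t * sin t) + ga * sin t ^+ 2))%:E
   = (2 * pi * (c + (al + ga) / 2))%:E)%E.
Proof.
pose f (t : R) := c + A * cos t + B * sin t +
      (al * cos t ^+ 2 + be * (cos t * sin t) + ga * sin t ^+ 2).
pose F (t : R) : R := c * t + A * sin t - B * cos t + (al / 2 * (t + sin t * cos t) +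
  be / 2 * sin t ^+ 2 + ga / 2 * (t - sin t * cos t)).
have dF (t : R) : is_derive t 1 F (f t).
  rewrite /F /f; apply: is_derive_eq; rewrite /GRing.scale/=.
  have E : cos t ^+ 2 = 1 - sin t ^+ 2 by rewrite sin2cos2; ring.
  by rewrite -[cos t * cos t]expr2 E; field.
have pi0 : 0 < 2 * pi :> R by rewrite mulr_gt0 ?pi_gt0.
have cF : continuous F.
  by move=> t; apply: differentiable_continuous; apply/derivable1_diffP; apply: ex_derive.
rewrite (@continuous_FTC2 _ f F)//.
- rewrite -EFinB; congr (_%:E); rewrite /F mulr_natl sin2pi cos2pi sin0 cos0 -mulr_natl.
  by field.
- apply: continuous_subspaceT => t.
  have cc := @continuous_cos R t; have cs := @continuous_sin R t.
  have cM c1 (f1 : R -> R) : {for t, continuous f1} -> {for t, continuous (fun x => c1 * f1 x)}.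
    by move=> ?; apply: continuousM => //; exact: cst_continuous.
  have c2 : {for t, continuous (fun x => cos x ^+ 2)} by exact: (continuousM cc cc).
  have s2 : {for t, continuous (fun x => sin x ^+ 2)} by exact: (continuousM cs cs).
  have sc : {for t, continuous (fun x => cos x * sin x)} by exact: (continuousM cc cs).
  rewrite /f; apply: cvgD; first apply: cvgD; first apply: cvgD.
  - exact: cvg_cst.
  - exact: cM.
  - exact: cM.
  - apply: cvgD; last exact: cM.
    by apply: cvgD; exact: cM.
- split.
  + by move=> t _; apply: ex_derive.
  + exact/cvg_at_right_filter/cF.
  + exact/cvg_at_left_filter/cF.
- by move=> t _; rewrite derive1E; apply: derive_val.
Qed.

Lemma circle_mean_le u p (r c A B al be ga : R) :
  (forall t, (u (p.1 + r * cos t, p.2 + r * sin t)%R <=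
    (c + A * cos t + B * sin t +
      (al * cos t ^+ 2 + be * (cos t * sin t) + ga * sin t ^+ 2))%:E)%E) ->
  (circle_mean u p r <= (c + (al + ga) / 2)%:E)%E.
Proof.
move=> ule; rewrite /circle_mean.
have pi0 : 0 < 2 * pi :> R by rewrite mulr_gt0 ?pi_gt0.
apply: (@le_trans _ _ (((2 * pi)^-1)%:E * (2 * pi * (c + (al + ga) / 2))%:E)%E).
  rewrite lee_wpmul2l ?lee_fin ?invr_ge0 ?(ltW pi0)//.
  rewrite -(integral_trig_quadratic c A B al be ga).
  by apply: le_integral_nomeas => t _; exact: ule.
by rewrite -EFinM mulKf ?gt_eqF.
Qed.

(** A function with the circle mean inequality cannot touch from below, at [p], a function with
    negative Laplacian at [p]: its mean would be too small. *)
Lemma circle_mean_jet_lt u h p v A B al be ga (D : set (R * R)) :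
  jet h p A B al be ga -> al + ga < 0 ->
  nbhs p D -> (forall q, D q -> (u q <= (h q + v)%:E)%E) ->
  exists2 r, 0 < r & closed_disc p r `<=` D /\ (circle_mean u p r < (h p + v)%:E)%E.
Proof.
move=> [C [d [C0 d0 d1 H]]] neg /nbhs_ballP[e /= e0 eD] uh.
pose s := - (al + ga).
have s0 : 0 < s by rewrite /s; lra.
(* On the circle [|r cos t| + |r sin t| <= 2 r], so the remainder is at most [8 C r^3]; the last
   bound on [r] puts it below [s r^2 / 2], the gain from the Laplacian. *)
pose r := Num.min (Num.min (d / 2) (e / 2)) (s / (16 * C + 1) / 2).
have C1 : 0 < 16 * C + 1 by lra.
have r0 : 0 < r by rewrite /r !lt_min !divr_gt0.
have rd : r <= d / 2 by rewrite /r !ge_min lexx.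
have re : r <= e / 2 by rewrite /r !ge_min lexx orbT.
have rs : r <= s / (16 * C + 1) / 2 by rewrite /r !ge_min lexx orbT.
have cD : closed_disc p r `<=` D.
  move=> q; rewrite /closed_disc /=; set S := Num.sqrt _ => Sr; apply: eD.
  have S1 : `|q.1 - p.1| <= S.
    by rewrite -sqrtr_sqr ler_wsqrtr// lerDl sqr_ge0.
  have S2 : `|q.2 - p.2| <= S.
    by rewrite -sqrtr_sqr ler_wsqrtr// lerDr sqr_ge0.
  split; rewrite /ball/= distrC; lra.
exists r => //; split => //.
apply: (@le_lt_trans _ _ (((h p + v + C * (2 * r) ^+ 3) + (al * r ^+ 2 + ga * r ^+ 2) / 2)%:E)).
  apply: (@circle_mean_le _ _ _ _ (A * r) (B * r) _ (be * r ^+ 2)) => t.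
  have ct : `|r * cos t| <= r.
    by rewrite normrM gtr0_norm// ler_piMr ?(ltW r0)// ler_norml cos_geN1 cos_le1.
  have st : `|r * sin t| <= r.
    by rewrite normrM gtr0_norm// ler_piMr ?(ltW r0)// ler_norml sin_geN1 sin_le1.
  apply: (@le_trans _ _ (h (p.1 + r * cos t, p.2 + r * sin t) + v)%:E).
    apply/uh/cD; rewrite /closed_disc/=;  rewrite ![_ + _ * _ t]addrC !addrK !exprMn -mulrDr.
    by rewrite cos2Dsin2 mulr1 sqrtr_sqr gtr0_norm.
  have := H (r * cos t) (r * sin t) ltac:(lra).
  rewrite ler_norml => /andP[_].
  have : (`|r * cos t| + `|r * sin t|) ^+ 3 <= (2 * r) ^+ 3.
    by rewrite lerXn2r// ?nnegrE ?addr_ge0//; lra.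
  move=> /(ler_wpM2l C0) h1 h2.
  rewrite lee_fin; move: (le_trans h2 h1); rewrite /quad.
  set X := h _; set Y := C * _ => /=; rewrite !exprMn; lra.
rewrite lte_fin; rewrite ler_pdivlMr// ler_pdivlMr// in rs.
have : r * (r * r * (16 * C + 1)) <= r * r * s / 2.
  by have := ler_wpM2l (ltW (mulr_gt0 r0 r0)) rs; lra.
have : 0 < r * r * r by rewrite !mulr_gt0.
rewrite /s !exprS expr0; nra.
Qed.

End maximum_principle.

Section max_principle.
Context {R : realType}.
Implicit Types (h : R * R -> R) (u : R * R -> \bar R) (p q : R * R).

(** The centre [(0, -2)] makes the argument of [ln] at least [3] on the upper half plane, so that
    the function is positive there; it tends to infinity at infinity. *)
Definition log_growth q : R := ln (q.1 ^+ 2 + (q.2 + 2) ^+ 2 - 1).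

Lemma log_growth_gt0 q : 0 <= q.2 -> 0 < log_growth q.
Proof. by move=> q2; apply: ln_gt0; have := sqr_ge0 q.1; nra. Qed.

(* Off the open unit disc, [ln (|z|^2 - 1)] is strictly superharmonic. *)
Lemma jet_log_growth q : 0 <= q.2 -> exists A B al be ga,
  jet log_growth q A B al be ga /\ al + ga < 0.
Proof.
move=> q2; pose f (z : R * R) : R := z.1 ^+ 2 + (z.2 + 2) ^+ 2 - 1.
have f0 : 0 < f q by rewrite /f; have := sqr_ge0 q.1; nra.
have jy := jetD (jet_snd q) (jet_cst 2 q).
have jf := jetD
  (jetD (jetM (jet_fst q) (jet_fst q))
    (jetM jy jy)) (jet_cst (-1) q).
have {}jf := jet_comp (jet1_ln _ f0) jf.
do 5 eexists; split; first exact: jf.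
rewrite /= !(mulr0, mul0r, addr0, add0r, mulr1, mul1r) -/(f q).
rewrite [X in X < 0](_ : _ = - 2 / f q ^+ 2); last first.
  have -> : (q.1 + q.1) ^+ 2 = 4 * (f q + 1 - (q.2 + 2) ^+ 2) by rewrite /f; ring.
  by field; rewrite gt_eqF.
by rewrite mulNr oppr_lt0 divr_gt0// exprn_gt0.
Qed.

(** [Om] may be unbounded and [u] is merely bounded above: the correction by [log_growth] takes care
    of infinity. The boundary condition is imposed at every point off [Om], so that compactness can
    be applied to a whole box; off the closure of [Om] it is vacuous. *)
Lemma maximum_principle (Om : set (R * R)) u h (m M : R) :
  (forall q, Om q -> 0 <= q.2) -> open Om ->
  (forall q (a : R), Om q -> (u q < a%:E)%E -> \forall z \near q, (u z < a%:E)%E) ->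
  (forall p (r : R), 0 < r -> closed_disc p r `<=` Om -> (u p <= circle_mean u p r)%E) ->
  (forall q, Om q -> (u q <= M%:E)%E) ->
  (forall q, Om q -> m <= h q) ->
  (forall q, Om q -> exists A B al be ga, jet h q A B al be ga /\ al + ga <= 0) ->
  (forall q (eps : R), ~ Om q -> 0 < eps -> \forall z \near q, Om z -> (u z <= (h z + eps)%:E)%E) ->
  forall q, Om q -> (u q <= (h q)%:E)%E.
Proof.
move=> Omy oOm usc submean uM hm hjet bdry z0 Oz0.
rewrite leNgt; apply/negP => hu.
have [x ux] : exists x : R, u z0 = x%:E.
  have := uM _ Oz0; move: hu; case: (u z0) => // x _ _; by exists x.
rewrite ux lte_fin in hu.
have L0 := log_growth_gt0 _ (Omy _ Oz0).
(* Adding [e * log_growth] makes [h] strictly superharmonic and infinite at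
   infinity, so that [u - w] attains its positive supremum [M0]. *)
pose e := (x - h z0) / (2 * log_growth z0).
have e0 : 0 < e by rewrite divr_gt0 ?mulr_gt0// subr_gt0.
pose w q := h q + e * log_growth q.
have wz0 : w z0 = (x + h z0) / 2 by rewrite /w /e; field; rewrite gt_eqF.
have wjet q : Om q -> exists A B al be ga, jet w q A B al be ga /\ al + ga < 0.
  move=> Oq; have [A [B [al [be [ga [jh ag]]]]]] := hjet _ Oq.
  have [A' [B' [al' [be' [ga' [jl ag']]]]]] := jet_log_growth _ (Omy _ Oq).
  do 5 eexists; split; first exact: jetD jh (jetZ e jl).
  nra.
have hw q : Om q -> h q <= w q.
  by move=> Oq; rewrite lerDl mulr_ge0 ?ltW// log_growth_gt0 ?Omy.
pose E := [set a : R | exists2 q, Om q & ((w q + a)%:E <= u q)%E].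
pose a0 := x - w z0.
have a00 : 0 < a0 by rewrite /a0 wz0; lra.
have Ea0 : E a0 by exists z0 => //; rewrite ux /a0 subrKC.
have hsE : has_sup E.
  split; first by exists a0.
  exists (M - m) => a [q Oq] /le_trans/(_ (uM _ Oq)); rewrite lee_fin.
  by have := hm _ Oq; have := hw _ Oq; lra.
pose M0 := sup E.
have a0M0 : a0 <= M0 by apply: ub_le_sup => //; exact: hsE.2.
have uw q : Om q -> (u q <= (w q + M0)%:E)%E.
  move=> Oq; rewrite leNgt; apply/negP; have := uM _ Oq; case uq : (u q) => [y| |]//.
  move=> _; rewrite lte_fin => wy.
  have : E (y - w q) by exists q => //; rewrite uq subrKC.
  by move/(ub_le_sup hsE.2); rewrite -/M0; lra.
(* An attained supremum contradicts the circle mean inequality, since [u] then touches the strictly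
   superharmonic [w + M0] from below at [q]. *)
have [[q Oq uq]|] := pselect (exists2 q, Om q & ((w q + M0)%:E <= u q)%E).
  have [A [B [al [be [ga [jw ag]]]]]] := wjet _ Oq.
  have [r r0 [cD]] := circle_mean_jet_lt u w q M0 A B al be ga Om jw ag
    (open_nbhs_nbhs (conj oOm Oq)) uw.
  by rewrite ltNge => /negP; apply; apply: (le_trans uq); exact: submean.
move=> noq.
have {noq}uw' q : Om q -> (u q < (w q + M0)%:E)%E.
  by move=> Oq; rewrite ltNge; apply/negP => H; apply: noq; exists q.
(* Outside the box, [log_growth] exceeds [(M - m) / e], whence [w > M >= u]. *)
pose K := expR ((M - m) / e).
have K0 : 0 < K := expR_gt0 _.
pose Bx := `[- (K + 1), K + 1] `*` `[0, K + 1] : set (R * R).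
have cB : compact Bx by apply: compact_setX; exact: segment_compact.
have far q : Om q -> ~ Bx q -> M < w q.
  move=> Oq nB; have q2 := Omy _ Oq.
  have : K < q.1 ^+ 2 + (q.2 + 2) ^+ 2 - 1.
    apply: contra_notT nB; rewrite -leNgt => f1.
    rewrite /Bx/=; rewrite !in_itv/= q2/=; rewrite -ler_norml.
    have n2 : `|q.1| ^+ 2 = q.1 ^+ 2 by rewrite real_normK ?num_real.
    by split; [have := normr_ge0 q.1|]; nra.
  move=> Kf; have : ln K < log_growth q by rewrite ltr_ln ?posrE// (lt_trans K0).
  rewrite expRK ltr_pdivrMr// mulrC /w.
  by have := hm _ Oq; lra.
(* Each point of [Bx] has a neighbourhood where all levels close to [M0] still bound [u - w]: at
   points of [Om] by semicontinuity of [u] and continuity of [w], elsewhere by the boundary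
   condition, as [a0 > 0]. Compactness makes this uniform, so that some level below [M0] bounds
   [u - w] everywhere. *)
have nc : \forall a \near M0^'-, Bx `<=` (fun q => Om q -> (u q < (w q + a)%:E)%E).
  apply: (compact_near_coveringP Bx).1 => // q Bq.
  have [Oq|nOq] := pselect (Om q).
    have [y uy yw] : exists2 y : R, (u q < y%:E)%E & y < w q + M0.
      have := uw' _ Oq; case: (u q) => [t| |]//; rewrite ?lte_fin => H.
        by exists ((t + (w q + M0)) / 2); rewrite ?lte_fin; lra.
      by exists (w q + M0 - 1); [exact: ltNyr|lra].
    have [A [B [al [be [ga [jw ag]]]]]] := wjet _ Oq.
    pose d := (w q + M0 - y) / 2.
    have d0 : 0 < d by rewrite /d; lra.
    exists ([set z | (u z < y%:E)%E /\ `|w z - w q| < d], [set a | M0 - d < a]).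
      split => /=; last by apply: nbhs_left_gt; lra.
      apply: filterI; first exact: usc.
      have /cvgrPdist_lt/(_ d d0) := jet_continuous jw.
      by apply: filterS => z /=; rewrite distrC.
    move=> [z a] /= [[uz]]; rewrite ltr_norml => /andP[wz _] aM Oz.
    by apply: (lt_trans uz); rewrite lte_fin; move: wz aM; rewrite /d; lra.
  exists ([set z | Om z -> (u z <= (h z + a0 / 4)%:E)%E], [set a | M0 - a0 / 2 < a]).
    split => /=; last by apply: nbhs_left_gt; lra.
    by apply: bdry => //; lra.
  move=> [z a] /= [uz aM] Oz; apply: (le_lt_trans (uz Oz)); rewrite lte_fin.
  by have := hw _ Oz; lra.
have [a [[nca aM] apos]] : exists a, (Bx `<=` (fun q => Om q -> (u q < (w q + a)%:E)%E) /\ a < M0) /\ 0 < a.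
  near M0^'- => a; exists a; split; first split; near: a => //.
  - exact: nbhs_left_lt.
  - by apply: nbhs_left_gt; lra.
suff : M0 <= a by rewrite leNgt aM.
apply: ge_sup; first by exists a0.
move=> b [q Oq wu]; have [Bq|nB] := pselect (Bx q).
  by have := le_lt_trans wu (nca _ Bq Oq); rewrite lte_fin; lra.
have := le_trans wu (uM _ Oq); rewrite lee_fin; have := far _ Oq nB; lra.
Unshelve. all: by end_near.
Qed.

End max_principle.

(** * Barriers in the half plane *)

Section barriers.
Context {R : realType}.
Implicit Types (q : R * R) (x a b s r : R).

Lemma atan_bounds s : 0 <= s -> s / (1 + s ^+ 2) <= atan s <= s.
Proof.
move=> s0; have [->|sn0] := eqVneq s 0; first by rewrite atan0 mul0r lexx.
have {sn0}s0 : 0 < s by rewrite lt_neqAle eq_sym sn0.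
have c0 : {within `[0, s], continuous (@atan R)}.
  by apply: continuous_subspaceT => x; exact: continuous_atan.
have [c /[!in_itv]/= /andP[c1 c2]] := MVT s0 (fun x _ => is_derive1_atan x) c0.
rewrite atan0 !subr0 => ->; have c20 := sqr_ge0 c.
apply/andP; split.
  rewrite mulrC ler_wpM2r ?(ltW s0)// lef_pV2 ?posrE; nra.
by rewrite ler_piMl ?(ltW s0)// invf_le1; lra.
Qed.

Lemma atan_inv s : 0 < s -> pi / 2 - atan s = atan s^-1.
Proof.
move=> s0; have a0 : 0 < atan s by rewrite -[ltLHS]atan0 lt_atan.
have ap := atan_ltpi2 s.
rewrite -[LHS]tanK; last by rewrite in_itv/=; apply/andP; split; lra.
congr atan; rewrite /tan sinB cosB sin_pihalf cos_pihalf !mul1r !mul0r subr0 add0r.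
by rewrite -[X in _ = X^-1]atanK /tan invf_div.
Qed.

(** The Poisson kernel of the upper half plane with pole [(x0, 0)], without its factor [1 / pi]. *)
Definition poisson x0 q : R := q.2 / ((q.1 - x0) ^+ 2 + q.2 ^+ 2).

(* For [a < b], the angle under which the segment from [(x0 + a, 0)] to
   [(x0 + b, 0)] is seen from a point [q] of the upper half plane. *)
Definition view_angle x0 a b q : R :=
  pi / 2 - atan (((q.1 - x0) ^+ 2 + q.2 ^+ 2 - (a + b) * (q.1 - x0) + a * b)
                 / ((b - a) * q.2)).

Lemma jet_shift x0 q : jet (fun z => z.1 - x0) q 1 0 0 0 0.
Proof. by apply: ord_eq (ord0 3) => u v; rewrite /quad/=; ring. Qed.

Lemma jet_sqdist x0 q : exists A B,
  [/\ jet (fun z => (z.1 - x0) ^+ 2 + z.2 ^+ 2) q A B 1 0 1,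
    A = 2 * (q.1 - x0) & B = 2 * q.2].
Proof.
exists (2 * (q.1 - x0)), (2 * q.2); split => //.
by apply: ord_eq (ord0 3) => u v; rewrite /quad/=; ring.
Qed.

Lemma jet_poisson x0 q : 0 < q.2 -> exists A B al be ga,
  jet (poisson x0) q A B al be ga /\ al + ga = 0.
Proof.
move=> q2; have [A [B [jd EA EB]]] := jet_sqdist x0 q.
pose d := (q.1 - x0) ^+ 2 + q.2 ^+ 2.
have d0 : 0 < d by rewrite ltr_wpDl ?sqr_ge0// exprn_gt0.
have ji := jet_comp (jet1_inv _ (lt0r_neq0 d0)) jd.
do 5 eexists; split; first exact: (jetM (jet_snd q) ji).
rewrite {ji jd} EA EB /=.
have E : (q.1 - x0) ^+ 2 = d - q.2 ^+ 2 by rewrite /d; ring.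
have -> : (2 * (q.1 - x0)) ^+ 2 = 4 * (d - q.2 ^+ 2) by rewrite -E; ring.
rewrite -/d; field; exact: lt0r_neq0.
Qed.

Lemma jet_view_angle x0 a b q : a < b -> 0 < q.2 -> exists A B al be ga,
  jet (view_angle x0 a b) q A B al be ga /\ al + ga = 0.
Proof.
move=> ab q2; have [A [B [jd EA EB]]] := jet_sqdist x0 q.
have jn := jetD (jetD jd
  (jetZ (- (a + b)) (jet_shift x0 q))) (jet_cst (a * b) q).
have jy := jet_comp (jet1_inv _ (lt0r_neq0 q2)) (jet_snd q).
have jw := jetZ (b - a)^-1 (jetM jn jy).
have jt := jetD (jet_cst (pi / 2) q)
  (jetZ (-1) (jet_comp (jet1_atan _) jw)).
do 5 eexists; split.
  apply: jet_eq jt => z; rewrite /view_angle mulN1r; congr (_ - atan _).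
  by rewrite invfM mulNr; ring.
rewrite {jt jw jn jy jd} EA EB /=.
set X := q.1 - x0; set y := q.2.
set N := X ^+ 2 + y ^+ 2 + - (a + b) * X + a * b.
have EX : (2 * X + - (a + b)) ^+ 2 = 4 * (N - y ^+ 2) + (b - a) ^+ 2.
  by rewrite /N; ring.
set W := (b - a)^-1 * (N * y^-1).
pose c := (b - a)^-1.
have ba : b - a != 0 by rewrite gt_eqF// subr_gt0.
have y0 : y != 0 by rewrite gt_eqF.
(* [S1] computes half the Laplacian of [W] and [S2] its squared gradient; they cancel in [lap (atan
   W) = lap W / (1 + W^2) - 2 W |grad W|^2 / (1 + W^2)^2]. *)
have S1 : c * N / y ^+ 3 = W / y ^+ 2 by rewrite /W /c; field; rewrite ?ba ?y0.
have S2 : c ^+ 2 * ((2 * X - (a + b)) ^+ 2 / y ^+ 2 + (2 - N / y ^+ 2) ^+ 2) =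
    (1 + W ^+ 2) / y ^+ 2.
  by rewrite EX /W /c; field; rewrite ?ba ?y0.
have W0 : 1 + W ^+ 2 != 0 by rewrite gt_eqF// ltr_wpDr// sqr_ge0.
rewrite [LHS](_ : _ = - ((1 + W ^+ 2)^-1 * (c * N / y ^+ 3)) +
    W / (1 + W ^+ 2) ^+ 2 *
    (c ^+ 2 * ((2 * X - (a + b)) ^+ 2 / y ^+ 2 + (2 - N / y ^+ 2) ^+ 2))); last first.
  rewrite -/c; clear S1 S2 EX; clearbody W c N.
  by field; rewrite ?y0 ?W0.
by rewrite S1 S2; field; rewrite ?W0 ?y0.
Qed.

Lemma view_angle_lt_pi x0 a b q : view_angle x0 a b q < pi.
Proof. rewrite /view_angle; set w := (X in atan X); have := atan_gtNpi2 w; lra. Qed.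

Lemma view_angle_gt0 x0 a b q : 0 < view_angle x0 a b q.
Proof. by rewrite /view_angle subr_gt0 atan_ltpi2. Qed.

Lemma view_angle_atan x0 a b q :
  let f := (q.1 - x0) ^+ 2 + q.2 ^+ 2 - (a + b) * (q.1 - x0) + a * b in
  a < b -> 0 < q.2 -> 0 < f -> view_angle x0 a b q = atan ((b - a) * q.2 / f).
Proof.
move=> f ab q2 f0; rewrite /view_angle -/f atan_inv ?invf_div//.
by rewrite divr_gt0// mulr_gt0// subr_gt0.
Qed.

Lemma poisson_gt0 x0 q : 0 < q.2 -> 0 < poisson x0 q.
Proof. by move=> q2; rewrite divr_gt0// ltr_wpDl ?sqr_ge0// exprn_gt0. Qed.

(** The right-hand side of the last hypothesis is the scalar product of the vectors from the two
    ends of the segment to [q]. Dividing [(b - a) * q.2] by it gives the tangent of the angle, and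
    [atan s <= s]. *)
Lemma view_angle_le x0 a b q (k : R) : a < b -> 0 < q.2 -> 0 < k ->
  k * ((q.1 - x0) ^+ 2 + q.2 ^+ 2) <=
    (q.1 - x0) ^+ 2 + q.2 ^+ 2 - (a + b) * (q.1 - x0) + a * b ->
  view_angle x0 a b q <= (b - a) / k * poisson x0 q.
Proof.
move=> ab q2 k0 kf; have ba : 0 < b - a by rewrite subr_gt0.
have d0 : 0 < (q.1 - x0) ^+ 2 + q.2 ^+ 2.
  by rewrite ltr_wpDl ?sqr_ge0// exprn_gt0.
have f0 := lt_le_trans (mulr_gt0 k0 d0) kf.
rewrite view_angle_atan//; set s := _ / _.
have s0 : 0 <= s by rewrite ltW// divr_gt0// mulr_gt0.
have /andP[_ /le_trans] := atan_bounds _ s0; apply.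
rewrite /s /poisson mulrACA -invfM ler_wpM2l ?(ltW (mulr_gt0 ba q2))//.
by rewrite lef_pV2// posrE mulr_gt0.
Qed.

Section step.
Variables (x0 r tau : R) (q : R * R).
Hypotheses (r0 : 0 < r) (q2 : 0 < q.2).
Let X := q.1 - x0.
Let y := q.2.
Let T := view_angle x0 (2 * r) (4 * r) q.
Let P := poisson x0 q.

Let angle_le (k : R) : 0 < k ->
  k * (X ^+ 2 + y ^+ 2) <= X ^+ 2 + y ^+ 2 - 6 * r * X + 8 * r ^+ 2 ->
  T <= 2 * r / k * P.
Proof.
move=> k0 kf; rewrite /T (_ : 2 * r / k = (4 * r - 2 * r) / k); last by congr (_ / _); ring.
apply: view_angle_le => //; first by have := r0; lra.
by apply: le_trans kf _; rewrite /X /y le_eqVlt; apply/orP; left; apply/eqP; ring.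
Qed.

(** Here [tau] stands for [theta rho]. Away from the segment the scalar product is at least a
    quarter of the squared distance, which gives [T <= 8 r P]. In the remaining box of side
    comparable to [r], the angle is at most [4] and the assumed height gives
    [P >= tau / (576 r)]. *)
Lemma step_angle_le : r ^+ 2 <= X ^+ 2 + y ^+ 2 -> 0 < tau <= 1 ->
  (r <= X <= 12 * r -> r * tau / 2 <= y) ->
  tau / ((64 * 64) * r) * T <= P.
Proof.
have r1 := r0; have y0 : 0 < y := q2.
move=> rho /andP[t0 t1] yX.
have P0 : 0 < P by exact: poisson_gt0.
suff : T <= 8 * r * P \/ r * tau / 2 <= y /\ y <= 12 * r /\ r <= X <= 12 * r.
  case=> [TP|[y1 [y2 /andP[X1 X2]]]].
    rewrite mulrAC ler_pdivrMr ?mulr_gt0//.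
    have rP : 0 < r * P by rewrite mulr_gt0.
    apply: (@le_trans _ _ (tau * (8 * r * P))); first by rewrite ler_wpM2l// ltW.
    have : tau * (r * P) <= r * P by rewrite ler_piMl// ltW.
    lra.
  have T4 : T <= 4.
    by rewrite ltW// (lt_le_trans (view_angle_lt_pi _ _ _ _))//; have := pihalf_lt2 R; lra.
  rewrite mulrAC ler_pdivrMr ?mulr_gt0//.
  apply: (@le_trans _ _ (tau * 4)); first by rewrite ler_wpM2l// ltW.
  rewrite /P /poisson -/X -/y mulrAC ler_pdivlMr; last first.
    by rewrite ltr_wpDl ?sqr_ge0// exprn_gt0.
  have D : X ^+ 2 + y ^+ 2 <= 288 * r ^+ 2.
    have : X ^+ 2 <= (12 * r) ^+ 2 by rewrite lerXn2r ?nnegrE//; lra.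
    have : y ^+ 2 <= (12 * r) ^+ 2 by rewrite lerXn2r ?nnegrE//; lra.
    lra.
  apply: (@le_trans _ _ (tau * 4 * (288 * r ^+ 2))).
    by rewrite ler_wpM2l// mulr_ge0// ltW.
  apply: (@le_trans _ _ (r * tau / 2 * ((64 * 64) * r))).
    have : 0 < tau * r ^+ 2 by rewrite mulr_gt0 ?exprn_gt0.
    by rewrite expr2; lra.
  by rewrite ler_wpM2r// mulr_ge0// ltW.
have far (k : R) : 4^-1 <= k -> k * (X ^+ 2 + y ^+ 2) <= X ^+ 2 + y ^+ 2 - 6 * r * X + 8 * r ^+ 2 ->
    T <= 8 * r * P.
  move=> k4 /angle_le => /(_ (lt_le_trans _ k4)) H.
  apply: (le_trans (H _)); first by rewrite invr_gt0.
  rewrite ler_wpM2r ?(ltW P0)// ler_pdivrMr ?(lt_le_trans _ k4)//.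
  by have := ler_wpM2l (ltW r1) k4; lra.
have [X1|X1] := leP X (3 / 2 * r).
  left; apply: (far (1 / 2)); first by lra.
  have : (9 / 2 * r) ^+ 2 <= (6 * r - X) ^+ 2 by rewrite lerXn2r ?nnegrE//; lra.
  by have := sqr_ge0 y; have := sqr_ge0 r; lra.
have [X2|X2] := leP X (12 * r); last first.
  left; apply: (far (1 / 2)); first by lra.
  have : (6 * r) ^+ 2 <= (X - 6 * r) ^+ 2 by rewrite lerXn2r ?nnegrE//; lra.
  by have := sqr_ge0 y; have := sqr_ge0 r; lra.
have [y1|y1] := leP y (12 * r); last first.
  left; apply: (far (1 / 4)); first by lra.
  have : (12 * r) ^+ 2 <= y ^+ 2 by rewrite lerXn2r ?nnegrE//; lra.
  by have := sqr_ge0 (X - 4 * r); have := sqr_ge0 r; lra.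
have rX : r <= X <= 12 * r by rewrite X2 andbT; lra.
right; split; first exact: yX.
by split => //; rewrite andbT; lra.
Qed.

(** Since [X <= 11/10 r], the scalar product is at least twice the squared distance, so the angle is
    half of what its behaviour at infinity would suggest. The annulus leaves room for the
    neighbourhoods of the points of the circle. *)
Lemma step_angle_near : r ^+ 2 <= X ^+ 2 + y ^+ 2 ->
  X ^+ 2 + y ^+ 2 <= (11 / 10 * r) ^+ 2 -> T <= r * P.
Proof.
have r1 := r0; have y0 : 0 < y := q2.
move=> d1 d2; rewrite (_ : r * P = 2 * r / 2 * P); last by field.
apply: angle_le => //.
have : X <= 11 / 10 * r.
  rewrite leNgt; apply/negP => H; have := sqr_ge0 y.
  have : (11 / 10 * r) ^+ 2 < X ^+ 2 by rewrite ltrXn2r ?nnegrE//; lra.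
  by lra.
by move=> /(ler_wpM2l (ltW r1)); lra.
Qed.

(** At infinity [T] is equivalent to [2 r P]; from distance [64 r] on, the errors in the scalar
    product and in [atan s >= s / (1 + s^2)] cost less than a quarter of it. *)
Lemma step_angle_far : (64 * r) ^+ 2 <= X ^+ 2 + y ^+ 2 -> 3 / 2 * (r * P) <= T.
Proof.
have r1 := r0; have y0 : 0 < y := q2.
move=> d1; have P0 : 0 < P by exact: poisson_gt0.
pose f := X ^+ 2 + y ^+ 2 - 6 * r * X + 8 * r ^+ 2.
pose d := X ^+ 2 + y ^+ 2.
have Xd (c : R) : 0 < c -> c * r * X <= c * d / 64 /\ - (c * d / 64) <= c * r * X.
  move=> c0; have X2 := sqr_ge0 X; have y2 := sqr_ge0 y.
  suff [H1 H2] : r * X <= d / 64 /\ - (d / 64) <= r * X.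
    by have := ler_wpM2l (ltW c0) H1; have := ler_wpM2l (ltW c0) H2; split; lra.
  have := sqr_ge0 (64 * r - X); have := sqr_ge0 (64 * r + X).
  rewrite /d in d1 *; split; lra.
have [a1 a2] := Xd 6 ltac:(lra).
have r2 : r ^+ 2 <= d / (64 * 64) by rewrite /d; lra.
have r20 : 0 < r ^+ 2 by rewrite exprn_gt0.
have fd : f <= 11 / 10 * d by rewrite /f -/d; lra.
have df : 9 / 10 * d <= f by rewrite /f -/d; lra.
have d0 : 0 < d by lra.
have f0 : 0 < f by lra.
rewrite /T view_angle_atan//; last 2 first.
- lra.
- by rewrite -/X -/y; rewrite /f in f0; lra.
rewrite -/X -/y (_ : _ + 2 * r * (4 * r) = f); last by rewrite /f; ring.
set s := _ / f.
have sE : s = 2 * r * y / f by rewrite /s; congr (_ / _); ring.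
have s0 : 0 < s by rewrite sE divr_gt0// !mulr_gt0.
have sP : 20 / 11 * (r * P) <= s.
  rewrite sE /P /poisson -/X -/y -/d ler_pdivlMr//.
  rewrite (_ : _ * f = 20 / 11 * r * y * (f / d)); last by field; rewrite gt_eqF.
  have fd1 : f / d <= 11 / 10 by rewrite ler_pdivrMr.
  have ry : 0 < r * y by rewrite mulr_gt0.
  by have := ler_wpM2l (ltW ry) fd1; lra.
have s1 : s <= 1 / 20.
  rewrite sE ler_pdivrMr//.
  have := sqr_ge0 (64 * r - y); have := sqr_ge0 X; rewrite /d in d1 d0 df *; lra.
have /andP[+ _] := atan_bounds _ (ltW s0); apply: le_trans.
rewrite ler_pdivlMr; last by rewrite ltr_wpDr// sqr_ge0.
have rP : 0 < r * P by rewrite mulr_gt0.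
have s2 : s ^+ 2 <= (1 / 20) ^+ 2 by rewrite lerXn2r ?nnegrE//; lra.
by have := ler_wpM2l (ltW rP) s2; lra.
Qed.

End step.

End barriers.

(** * Decay of the Perron family *)

Section epigraph_topology.
Context {R : realType} (phi : R -> R).
Hypothesis cphi : continuous phi.
Implicit Types (q : R * R).

Lemma continuous_phi_fst : continuous (fun q : R * R => phi q.1).
Proof. by move=> q; apply: continuous_comp; [exact: cvg_fst|exact: cphi]. Qed.

Lemma open_epigraph : open (epigraph phi).
Proof.
rewrite (_ : epigraph phi = (fun q => q.2 - phi q.1) @^-1` [set x | 0 < x]); last first.
  by apply/seteqP; split => q /=; rewrite /epigraph/= subr_gt0.
apply: open_comp; last exact: open_gt.
move=> q _; apply: cvgB; [exact: cvg_snd|exact: continuous_phi_fst].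
Qed.

Lemma near_below_graph q : q.2 < phi q.1 -> \forall z \near q, ~ epigraph phi z.
Proof.
move=> q2; have : open ((fun q => phi q.1 - q.2) @^-1` [set x | 0 < x]).
  apply: open_comp; last exact: open_gt.
  by move=> z _; apply: cvgB; [exact: continuous_phi_fst|exact: cvg_snd].
move=> o; have : nbhs q ((fun q => phi q.1 - q.2) @^-1` [set x | 0 < x]).
  by apply: open_nbhs_nbhs; split => //=; rewrite subr_gt0.
by apply: filterS => z /=; rewrite subr_gt0 /epigraph/= => /ltW; rewrite leNgt => /negP.
Qed.

Lemma boundary_epigraph q : boundary (epigraph phi) q <-> q.2 = phi q.1.
Proof.
rewrite /boundary /setD/=.
have -> : (epigraph phi)° = epigraph phi.
  have := open_epigraph; rewrite openE => oE.
  by apply/seteqP; split; [exact: interior_subset|exact: oE].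
split=> [[clq /negP nq]|q2].
  apply/eqP; rewrite eq_le; apply/andP; split.
    by move/negP: nq; rewrite /epigraph/= => /negP; rewrite -leNgt.
  rewrite leNgt; apply/negP => /near_below_graph H.
  by have [z [Dz nDz]] := clq _ H.
split; last by rewrite /epigraph/= q2 ltxx.
move=> B /nbhs_ballP[e /= e0 eB]; exists (q.1, q.2 + e / 2); split.
  by rewrite /epigraph/= q2 ltrDl divr_gt0.
apply: eB; split; rewrite /ball/= ?subrr ?normr0//.
by rewrite opprD addNKr normrN gtr0_norm ?divr_gt0//; lra.
Qed.

End epigraph_topology.

Section perron_bound.
Context {R : realType}.
Variables (phi theta : R -> R) (x0 delta : R).
Hypothesis cphi : continuous phi.
Hypothesis phi0 : forall x, 0 <= phi x.
Hypothesis theta_pos : forall r : R, 0 < r -> 0 < theta r.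
Hypothesis theta_mono : forall r s : R, 0 < r -> r <= s -> theta r <= theta s.
Hypothesis phi_theta :
  forall s, 0 < s -> s < delta -> s / 2 * theta s <= phi (x0 + s).
Local Notation D := (epigraph phi).
Local Notation P := (poisson x0).
Implicit Types (q : R * R) (u : R * R -> \bar R) (f : R * R -> R).

Definition sqdist (q : R * R) : R := (q.1 - x0) ^+ 2 + q.2 ^+ 2.

Lemma continuous_sqdist : continuous sqdist.
Proof.
move=> q; have [A [B [/jet_continuous]]] := jet_sqdist x0 q; exact.
Qed.

Lemma near_sqdist_lt q (c : R) : sqdist q < c -> \forall z \near q, sqdist z < c.
Proof. by move=> qc; exact: (cvgr_lt _ (continuous_sqdist q)). Qed.

Lemma perron_near u f q (e : R) : perron_family D f u -> q.2 = phi q.1 -> 0 < e ->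
  \forall z \near q, D z -> (u z <= (f q + e)%:E)%E.
Proof.
move=> [_ _ /(_ q)]; rewrite boundary_epigraph// => + q2 e0.
move=> /(_ q2); rewrite limf_esupE => le_f.
have /ereal_inf_lt : (ereal_inf [set ereal_sup (u @` V) | V in within D (nbhs q)] < (f q + e)%:E)%E.
  by apply: (le_lt_trans le_f); rewrite lte_fin ltrDl.
move=> [_ [V /= nV <-] ltV]; move: nV; rewrite /within/=.
apply: filterS => z zV Dz; apply: le_trans (ltW ltV).
by apply: ereal_sup_ubound; exists z => //; exact: zV.
Qed.

Lemma epigraph_snd_gt0 q : D q -> 0 < q.2.
Proof. exact: le_lt_trans. Qed.

(** The maximum principle on the part of the domain outside a disc, with its boundary condition
    split: near the disc an earlier bound on [u] is to be used, near the graph the boundary data. *)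
Lemma perron_le u f h (c : R) : perron_family D f u ->
  (forall q, D q -> c < sqdist q -> 0 <= h q) ->
  (forall q, D q -> exists A B al be ga, jet h q A B al be ga /\ al + ga <= 0) ->
  (forall q, sqdist q <= c ->
    \forall z \near q, D z -> c < sqdist z -> (u z <= (h z)%:E)%E) ->
  (forall q (e : R), q.2 = phi q.1 -> c < sqdist q -> 0 < e ->
     \forall z \near q, D z -> c < sqdist z -> (u z <= (h z + e)%:E)%E) ->
  forall q, D q -> c < sqdist q -> (u q <= (h q)%:E)%E.
Proof.
move=> fam h0 hjet inner outer q Dq cq.
have [[uoo usc usub] [M uM] ubd] := fam.
apply: (maximum_principle (D `&` [set z | c < sqdist z]) u h 0 M) => //.
- by move=> z [/epigraph_snd_gt0/ltW].
- apply: openI; first exact: (open_epigraph _ cphi).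
  rewrite (_ : [set z | _] = sqdist @^-1` [set x | c < x])//.
  by apply: open_comp; [move=> z _; exact: continuous_sqdist|exact: open_gt].
- by move=> z a [Dz _]; exact: usc.
- move=> p r r0 pD; apply: usub => //; by apply: (subset_trans pD) => z [].
- by move=> z [Dz _]; exact: uM.
- by move=> z [Dz cz]; exact: h0.
- by move=> z [Dz _]; exact: hjet.
- move=> z e nz e0; have [zc|cz] := leP (sqdist z) c.
    have := inner _ zc; apply: filterS => w H [Dw cw].
    by apply: (le_trans (H Dw cw)); rewrite lee_fin lerDl ltW.
  have [z2|z2|z2] := ltgtP z.2 (phi z.1).
  + by have := near_below_graph _ cphi _ z2; apply: filterS => w nw [].
  + by exfalso; apply: nz.
  + by have := outer _ _ z2 cz e0; apply: filterS => w H [Dw cw]; exact: H.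
Qed.

Section bump.
Variables (f : R * R -> R) (r : R).
Hypothesis r0 : 0 < r.
Hypothesis f_le1 : forall q, f q <= 1.
Hypothesis f_far : forall q, 8 * r ^+ 2 <= sqdist q -> f q = 0.

(** From the half disc over it, which contains the support of [f], the segment of half-length [4 r]
    is seen under an angle at least [pi / 2 >= 1]. At distance [8 r] the scalar product is at least
    [3/4] of the squared distance, and [8 r / (3 / 4) <= 11 r]. *)
Lemma perron_base u : perron_family D f u ->
  forall q, D q -> (8 * r) ^+ 2 <= sqdist q -> (u q <= (11 * r * P q)%:E)%E.
Proof.
move=> fam q Dq dq; have r1 := r0; have q2 := epigraph_snd_gt0 _ Dq.
have d0 : 0 < sqdist q by apply: lt_le_trans dq; rewrite exprn_gt0//; lra.
pose h := view_angle x0 (- (4 * r)) (4 * r).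
apply: (@le_trans _ _ (h q)%:E); last first.
  rewrite lee_fin; apply: (@le_trans _ _ ((4 * r - - (4 * r)) / (3 / 4) * P q)).
    apply: view_angle_le => //.
      by lra.
    by rewrite -/(sqdist q); lra.
  rewrite ler_wpM2r ?(ltW (poisson_gt0 _ _ _))//; lra.
(* As [sqdist] is nonnegative, [-1] removes no disc. *)
apply: (perron_le u f h (-1) fam) => //.
- by move=> z Dz _; exact/ltW/view_angle_gt0.
- move=> z Dz; have [|A [B [al [be [ga [jh E]]]]]] :=
    jet_view_angle x0 (- (4 * r)) (4 * r) z _ (epigraph_snd_gt0 _ Dz); first by lra.
  by do 5 eexists; split; [exact: jh|rewrite E].
- by move=> z; rewrite leNgt (lt_le_trans (ltrN10 _))// addr_ge0 ?sqr_ge0.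
- move=> z e z2 _ e0; have [zr|zr] := ltP (sqdist z) (8 * r ^+ 2).
    have zr16 : sqdist z < 16 * r ^+ 2 by have := sqr_ge0 r; lra.
    have := near_sqdist_lt _ _ zr16; have := perron_near _ _ _ _ fam z2 e0.
    apply: filterS2 => w uw dw Dw _; apply: (le_trans (uw Dw)).
    rewrite lee_fin lerD2r; apply: (le_trans (f_le1 _)).
    have p1 : 1 <= pi / 2 :> R by rewrite ler_pdivlMr// mul1r pi_ge2.
    apply: (le_trans p1); rewrite /h /view_angle lerDl oppr_ge0 -atan0 le_atan//.
    rewrite mulr_le0_ge0//.
      by rewrite -/(sqdist w); lra.
    by rewrite invr_ge0 mulr_ge0 ?(ltW (epigraph_snd_gt0 _ Dw))//; lra.
  have := perron_near _ _ _ _ fam z2 e0; apply: filterS => w uw Dw _.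
  apply: (le_trans (uw Dw)); rewrite f_far// lee_fin lerD2r.
  exact/ltW/view_angle_gt0.
- by apply: lt_trans d0; lra.
Qed.

(* [h = A (P - k (T - rho P))] is at least [A P] just outside the disc of radius
   [rho], nonnegative on the domain, and at most [A (1 - k rho / 2) P] far away. *)
Lemma perron_step u (A rho : R) : perron_family D f u -> 0 <= A ->
  8 * r <= rho -> 12 * rho < delta -> theta rho <= 1 ->
  (forall q, D q -> rho ^+ 2 <= sqdist q -> (u q <= (A * P q)%:E)%E) ->
  forall q, D q -> (64 * rho) ^+ 2 <= sqdist q ->
    (u q <= (A * (1 - theta rho / (128 * 64)) * P q)%:E)%E.
Proof.
move=> fam A0 rrho rhod th1 uP q Dq dq; have r1 := r0.
have rho0 : 0 < rho by lra.
have th0 := theta_pos _ rho0.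
pose T := view_angle x0 (2 * rho) (4 * rho).
pose k := theta rho / ((64 * 64) * rho).
have k0 : 0 < k by rewrite divr_gt0// mulr_gt0.
pose h z := A * (P z + (- k) * (T z + (- rho) * P z)).
have hle z : D z -> rho ^+ 2 <= sqdist z -> 0 <= P z - k * T z.
  move=> Dz dz; rewrite subr_ge0 /k /T.
  apply: step_angle_le => //; first exact: epigraph_snd_gt0.
    by rewrite th0.
  (* The point lies above the graph, whose height at [x0 + X] is at least
     [X / 2 * theta X >= rho / 2 * theta rho]; this is available because [X <= 12 rho < delta]. *)
  move=> /andP[X1 X2]; apply: (le_trans _ (ltW Dz)).
  have X0 : 0 < z.1 - x0 by lra.
  have := phi_theta _ X0 ltac:(lra); rewrite subrKC; apply: le_trans.
  have := theta_mono _ _ rho0 X1; nra.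
have := uP; have P0 z : D z -> 0 < P z by move=> /epigraph_snd_gt0; exact: poisson_gt0.
move=> _; apply: (@le_trans _ _ (h q)%:E); last first.
  have Tq : 3 / 2 * (rho * P q) <= T q.
    by apply: step_angle_far => //; exact: epigraph_snd_gt0.
  rewrite lee_fin /h -mulrA ler_wpM2l//.
  have : k * (1 / 2 * (rho * P q)) <= k * (T q - rho * P q).
    by rewrite ler_wpM2l ?(ltW k0)//; lra.
  rewrite (_ : k * (1 / 2 * (rho * P q)) = theta rho / (128 * 64) * P q); first by lra.
  by rewrite /k; field; rewrite gt_eqF.
have dq' : rho ^+ 2 < sqdist q.
  by apply: lt_le_trans dq; rewrite ltrXn2r ?nnegrE//; lra.
apply: (perron_le u f h (rho ^+ 2) fam) => //.
- move=> z Dz /ltW dz; rewrite /h mulr_ge0//; have := hle _ Dz dz.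
  have : 0 <= k * (rho * P z) := mulr_ge0 (ltW k0) (mulr_ge0 (ltW rho0) (ltW (P0 _ Dz))).
  by lra.
- move=> z Dz; have z2 := epigraph_snd_gt0 _ Dz.
  have [A1 [B1 [al1 [be1 [ga1 [j1 E1]]]]]] := jet_poisson x0 z z2.
  have [|A2 [B2 [al2 [be2 [ga2 [j2 E2]]]]]] :=
    jet_view_angle x0 (2 * rho) (4 * rho) z _ z2; first by lra.
  do 5 eexists; split.
    exact: (jetZ A (jetD j1
      (jetZ (- k) (jetD j2
        (jetZ (- rho) j1))))).
  rewrite (_ : _ + _ = A * ((al1 + ga1) + - k * ((al2 + ga2) + - rho * (al1 + ga1)))); last by ring.
  by rewrite E1 E2 !(mulr0, addr0).
- move=> z dz; have : sqdist z < (11 / 10 * rho) ^+ 2.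
    by apply: (le_lt_trans dz); rewrite ltrXn2r ?nnegrE//; lra.
  move=> /near_sqdist_lt; apply: filterS => w dw Dw cw.
  apply: (le_trans (uP _ Dw (ltW cw))); rewrite lee_fin ler_wpM2l//.
  have : T w <= rho * P w.
    by apply: step_angle_near => //; [exact: epigraph_snd_gt0|exact: ltW|exact: ltW].
  by nra.
- move=> z e z2 cz e0; have := perron_near _ _ _ _ fam z2 e0.
  apply: filterS => w uw Dw cw; apply: (le_trans (uw Dw)).
  rewrite f_far; last first.
    apply: (le_trans _ (ltW cz)); apply: (@le_trans _ _ ((8 * r) ^+ 2)).
      by have := sqr_ge0 r; lra.
    by rewrite lerXn2r ?nnegrE//; lra.
  rewrite lee_fin lerD2r /h mulr_ge0//; have := hle _ Dw (ltW cw).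
  have : 0 <= k * (rho * P w) := mulr_ge0 (ltW k0) (mulr_ge0 (ltW rho0) (ltW (P0 _ Dw))).
  by lra.
Qed.

(** [1 - s <= expR (- s)] turns the product of the gains of [perron_step] into a sum. *)
Lemma perron_iter u (J : nat) : perron_family D f u ->
  (forall i, (i < J)%N -> 12 * (64 ^+ i * (8 * r)) < delta /\ theta (64 ^+ i * (8 * r)) <= 1) ->
  forall q, D q -> (64 ^+ J * (8 * r)) ^+ 2 <= sqdist q ->
    (u q <= (11 * r * expR (- (\sum_(i < J) theta (64 ^+ i * (8 * r))) / (128 * 64)) * P q)%:E)%E.
Proof.
move=> fam; have r1 := r0; elim: J => [_ q Dq|J IH HJ q Dq dq].
  by rewrite expr0 mul1r big_ord0 oppr0 mul0r expR0 mulr1; exact: perron_base.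
have {}IH := IH (fun i iJ => HJ i (ltnW iJ)).
have [H1 H2] := HJ J (ltnSn J).
have J1 : 1 <= 64 ^+ J :> R by rewrite exprn_ege1//; lra.
set S := \sum_(i < J) _ in IH.
have A0 : 0 <= 11 * r * expR (- S / (128 * 64)) by rewrite !mulr_ge0 ?expR_ge0//; lra.
have := perron_step u _ (64 ^+ J * (8 * r)) fam A0 _ H1 H2 IH q Dq.
rewrite big_ord_recr/= -/S (_ : 64 * _ = 64 ^+ J.+1 * (8 * r)); last by rewrite exprS mulrA.
move=> /(_ _ dq) H.
apply: (le_trans (H _)); first by rewrite ler_peMl//; lra.
rewrite lee_fin ler_wpM2r//.
  exact/ltW/poisson_gt0/epigraph_snd_gt0.
set t := theta _.
have -> : expR (- (S + t) / (128 * 64)) = expR (- S / (128 * 64)) * expR (- t / (128 * 64)).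
  by rewrite -expRD; congr expR; ring.
rewrite mulrA ler_wpM2l//.
by have := expR_ge1Dx (- t / (128 * 64)); lra.
Qed.

End bump.
End perron_bound.

(** * Vanishing density *)

Section dyadic.
Context {R : realType}.

Lemma exp_bracket (b x : R) : 2 <= b -> 1 <= x ->
  exists n : nat, b ^+ n <= x < b ^+ n.+1.
Proof.
move=> b2 x1; have b0 : 0 < b by lra.
have ex : exists n, x < b ^+ n.
  exists (Num.bound x); have x0 : 0 <= x by lra.
  apply: (lt_le_trans (archi_boundP x0)).
  apply: (@le_trans _ _ (2 ^+ Num.bound x)).
    by rewrite -natrX ler_nat ltnW// ltn_expl.
  by rewrite lerXn2r// nnegrE; lra.
case: (ex_minnP ex) => -[|n] xn nmin; first by rewrite expr0 in xn; lra.
exists n; rewrite xn andbT leNgt; apply/negP => /nmin.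
by rewrite ltnn.
Qed.

(** By monotonicity [theta r / r] is at most the constant [c m] on the [m]-th interval of ratio
    [64], and the integral of that constant is [63 * theta (rho / 64 ^+ m)]. Bounded partial sums
    would make the integral finite. *)
Lemma nondini_sum (theta : R -> R) :
  (forall r : R, 0 < r -> 0 < theta r) ->
  (forall r s : R, 0 < r -> r <= s -> theta r <= theta s) ->
  integral_diverges_at0 theta ->
  forall rho B : R, 0 < rho ->
    exists N, forall J, (N <= J)%N -> B <= \sum_(i < J) theta (rho / 64 ^+ i).
Proof.
move=> tpos tmono tdiv rho B rho0.
have p64 i : 0 < 64 ^+ i :> R by rewrite exprn_gt0.
apply: contrapT => /forallNP H.
have {}H N : \sum_(i < N) theta (rho / 64 ^+ i) <= B.
  have /existsNP[J /not_implyP[NJ /negP]] := H N; rewrite -ltNge => /ltW; apply: le_trans.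
  rewrite -(subnKC NJ) big_split_ord/= lerDl sumr_ge0// => i _.
  by rewrite ltW// tpos// divr_gt0.
pose I (m : nat) : set R := [set` `]rho / 64 ^+ m.+1, rho / 64 ^+ m]].
pose c m := theta (rho / 64 ^+ m) / (rho / 64 ^+ m.+1).
have c0 m : 0 <= c m by rewrite ltW// divr_gt0 ?tpos// divr_gt0.
pose g m (x : R) : \bar R := (c m * \1_(I m) x)%:E.
have g0 m x : (0 <= g m x)%E by rewrite lee_fin mulr_ge0.
have mg m : measurable_fun [set: R] (g m).
  apply/measurable_EFinP; apply: measurable_funM; first exact: measurable_cst.
  by apply: measurable_indic; exact: measurable_itv.
have lt_oo : (\int[lebesgue_measure]_(r in `]0%R, rho[) (theta r / r)%:E
    <= \int[lebesgue_measure]_(r in setT) (\sum_(m <oo) g m r))%E.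
  rewrite [leLHS]integral_mkcond/=; apply: le_integral_nomeas => x _.
  rewrite /patch; case: ifPn => [|_]; last exact: nneseries_ge0.
  rewrite inE/= in_itv/= => /andP[x0 xr].
  have [||n /andP[n1 n2]] := @exp_bracket 64 (rho / x) _ _.
  - by lra.
  - by rewrite ler_pdivlMr// mul1r ltW.
  rewrite ler_pdivlMr// -ler_pdivlMl// mulrC in n1.
  rewrite ltr_pdivrMr// -ltr_pdivrMl// mulrC in n2.
  apply: (@le_trans _ _ (g n x)).
    rewrite lee_fin /g indicE mem_set ?mulr1; last by rewrite /I/= in_itv/= n1 n2.
    rewrite /c; apply: ler_pM.
    + by rewrite ltW// tpos.
    + by rewrite invr_ge0 ltW.
    + exact: tmono.
    + by rewrite lef_pV2 ?posrE ?divr_gt0// ltW.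
  apply: (@le_trans _ _ (\sum_(0 <= i < n.+1) g i x)%E).
    by rewrite big_nat_recr//= leeDr// sume_ge0.
  exact: nneseries_lim_ge.
have := tdiv _ rho0; move: lt_oo; rewrite integral_nneseries//.
move=> /[swap] ->; apply/negP; rewrite -ltNge.
apply: (@le_lt_trans _ _ (63 * B)%:E); last exact: ltry.
apply: lime_le; first by apply: is_cvg_nneseries => m _ _; exact: integral_ge0.
apply: nearW => n.
have E m : (\int[lebesgue_measure]_x g m x = (63 * theta (rho / 64 ^+ m))%:E)%E.
  rewrite /g; under eq_integral do rewrite EFinM.
  rewrite ge0_integralZl_EFin//; last first.
    by apply/measurable_EFinP; apply: measurable_indic; exact: measurable_itv.
  rewrite integral_indic//; last exact: measurable_itv.
  have muI : lebesgue_measure (I m) = (rho / 64 ^+ m - rho / 64 ^+ m.+1)%:E.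
    rewrite /I lebesgue_measure_itv/= lte_fin ltr_pM2l//.
    by rewrite ltf_pV2 ?posrE// ltr_eXn2l ?ltnSn//; lra.
  rewrite setIT [X in (_ * X)%E](_ : _ = (rho / 64 ^+ m - rho / 64 ^+ m.+1)%:E); last exact: muI.
  by rewrite -EFinM; congr (_%:E); rewrite /c exprS; field; rewrite !gt_eqF.
under eq_bigr do rewrite E.
rewrite sumEFin lee_fin -mulr_sumr ler_wpM2l// big_mkord.
exact: H.
Qed.

End dyadic.

Section limits.
Context {R : realType}.

Lemma cvg_maxr (T : Type) (F : set_system T) (f g : T -> R) (a b : R) : Filter F ->
  f x @[x --> F] --> a -> g x @[x --> F] --> b ->
  Num.max (f x) (g x) @[x --> F] --> Num.max a b.
Proof.
move=> FF fa gb; rewrite maxr_absE; under eq_cvg do rewrite maxr_absE.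
by apply: cvgM; [apply: cvgD; [exact: cvgD|apply: cvg_norm; exact: cvgB]|exact: cvg_cst].
Qed.

Lemma cvg_minr (T : Type) (F : set_system T) (f g : T -> R) (a b : R) : Filter F ->
  f x @[x --> F] --> a -> g x @[x --> F] --> b ->
  Num.min (f x) (g x) @[x --> F] --> Num.min a b.
Proof.
move=> FF fa gb; rewrite minr_absE; under eq_cvg do rewrite minr_absE.
by apply: cvgM; [apply: cvgB; [exact: cvgD|apply: cvg_norm; exact: cvgB]|exact: cvg_cst].
Qed.

Lemma limf_squeeze0 (f : R -> \bar R) :
  (forall e : R, 0 < e -> \forall r \near 0^'+, (0 <= f r <= e%:E)%E) ->
  limf_einf f 0^'+ = 0%E /\ limf_esup f 0^'+ = 0%E.
Proof.
move=> H; have FF := at_right_proper_filter (0 : R).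
have H1 := H 1 ltr01.
split; apply/eqP; rewrite eq_le; apply/andP; split.
- rewrite limf_einfE; apply: ge_ereal_sup => _ [V /= FV <-].
  apply/lee_addgt0Pr => e e0; rewrite add0e.
  have [r [Vr /andP[_ fe]]] := filter_ex (filterI FV (H e e0)).
  by apply: le_trans fe; apply: ereal_inf_lbound; exists r.
- rewrite limf_einfE; apply: le_ereal_sup_tmp; exists (ereal_inf (f @` [set r | (0 <= f r)%E])).
    by exists [set r | (0 <= f r)%E] => //; apply: filterS H1 => r /andP[].
  by apply: le_ereal_inf_tmp => _ [r /= fr <-].
- apply/lee_addgt0Pr => e e0; rewrite add0e limf_esupE.
  apply: (@le_trans _ _ (ereal_sup (f @` [set r | (f r <= e%:E)%E]))).
    apply: ereal_inf_lbound; exists [set r | (f r <= e%:E)%E] => //.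
    by apply: filterS (H e e0) => r /andP[].
  by apply: ge_ereal_sup => _ [r /= fr <-].
- rewrite limf_esupE; apply: le_ereal_inf_tmp => _ [V /= FV <-].
  have [r [Vr /andP[f0 _]]] := filter_ex (filterI FV H1).
  by apply: (le_trans f0); apply: ereal_sup_ubound; exists r.
Qed.

End limits.

(** * Harmonic measure of small surface balls *)

Section zero_density.
Context {R : realType}.
Variables (phi theta : R -> R) (x0 delta : R).
Hypothesis cphi : continuous phi.
Hypothesis phi0 : forall x, 0 <= phi x.
Hypothesis theta_pos : forall r : R, 0 < r -> 0 < theta r.
Hypothesis theta_mono : forall r s : R, 0 < r -> r <= s -> theta r <= theta s.
Hypothesis theta_lim0 : theta r @[r --> 0^'+] --> (0 : R).
Hypothesis theta_nondini : integral_diverges_at0 theta.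
Hypothesis delta0 : 0 < delta.
Hypothesis phi_theta :
  forall s, 0 < s -> s < delta -> s / 2 * theta s <= phi (x0 + s).
Hypothesis phix0 : phi x0 = 0.
Local Notation D := (epigraph phi).
Variables (X : R * R)
  (omega : probability (measurableTypeR R * measurableTypeR R)%type R).
Hypothesis DX : D X.
Hypothesis hm : is_harmonic_measure D X omega.

(** A continuous majorant of the indicator of the disc of radius [r]: harmonic measure is known only
    through its integrals of continuous data. *)
Definition bump (r : R) (q : R * R) : R :=
  Num.max 0 (Num.min 1 (2 - sqdist x0 q / r ^+ 2)).

Lemma bump_ge0 r q : 0 <= bump r q.
Proof. by rewrite /bump le_max lexx. Qed.

Lemma bump_le1 r q : bump r q <= 1.
Proof. by rewrite /bump ge_max ler01 ge_min lexx. Qed.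

Lemma bump_far r q : 0 < r -> 2 * r ^+ 2 <= sqdist x0 q -> bump r q = 0.
Proof.
move=> r0 d; apply/max_idPl; rewrite ge_min; apply/orP; right.
by rewrite subr_le0 ler_pdivlMr// exprn_gt0.
Qed.

Lemma bump_near r q : 0 < r -> sqdist x0 q <= r ^+ 2 -> bump r q = 1.
Proof.
move=> r0 d; rewrite /bump (min_idPl _).
  by apply/max_idPr.
have : sqdist x0 q / r ^+ 2 <= 1 by rewrite ler_pdivrMr ?exprn_gt0// mul1r.
lra.
Qed.

Lemma continuous_bump r : continuous (bump r).
Proof.
move=> q; apply: cvg_maxr; first exact: cvg_cst.
apply: cvg_minr; first exact: cvg_cst.
apply: cvgB; first exact: cvg_cst.
by apply: cvgM; [exact: continuous_sqdist|exact: cvg_cst].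
Qed.

Lemma bump_boundary_data r : 0 < r -> boundary_data D (bump r).
Proof.
move=> r0; split; first exact/continuous_subspaceT/continuous_bump.
exists (`[x0 - 2 * r, x0 + 2 * r] `*` `[- (2 * r), 2 * r]).
  by apply: compact_setX; exact: segment_compact.
move=> q [_ nK]; apply: bump_far => //; rewrite leNgt; apply/negP => dq; apply: nK.
have X2 := sqr_ge0 (q.1 - x0); have y2 := sqr_ge0 q.2.
have ab (a : R) : a ^+ 2 < 2 * r ^+ 2 -> - (2 * r) <= a <= 2 * r.
  move=> a2; rewrite -ler_norml -ler_sqr ?nnegrE; [|by []|by lra].
  by rewrite real_normK ?num_real//; have := sqr_ge0 r; lra.
rewrite /sqdist in dq; split => /=; rewrite in_itv/=.
  have := ab (q.1 - x0) ltac:(lra); lra.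
exact: (ab q.2 ltac:(lra)).
Qed.

Lemma measurable_sqdist : measurable_fun [set: R * R] (sqdist x0).
Proof.
apply: measurable_funD; apply: measurable_funX.
  by apply: measurable_funB; [exact: measurable_fst|exact: measurable_cst].
exact: measurable_snd.
Qed.

(** Written with preimages under measurable functions, the ball is measurable for the product
    sigma-algebra. *)
Lemma surface_ballE r : 0 < r -> surface_ball D (x0, 0) r =
  ((fun q => q.2 - phi q.1) @^-1` [set 0]) `&` (sqdist x0 @^-1` [set` `]-oo, r ^+ 2[]).
Proof.
move=> r0; have E q : (Num.sqrt ((q.1 - x0) ^+ 2 + (q.2 - 0) ^+ 2) < r) = (sqdist x0 q < r ^+ 2).
  rewrite subr0 -/(sqdist x0 q) -{1}[r]ger0_norm ?(ltW r0)// -sqrtr_sqr.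
  by rewrite ltr_sqrt// exprn_gt0.
apply/seteqP; split => q; rewrite /surface_ball /disc/= E in_itv/=.
- by move=> [/(boundary_epigraph _ cphi) -> ?]; rewrite subrr.
- by move=> [/eqP + ?]; rewrite subr_eq0 => /eqP qE; split => //; apply/(boundary_epigraph _ cphi).
Qed.

Lemma measurable_graph : measurable_fun [set: R * R] (fun q : R * R => q.2 - phi q.1).
Proof.
apply: measurable_funB; first exact: measurable_snd.
apply: measurableT_comp; last exact: measurable_fst.
exact: continuous_measurable_fun.
Qed.

Lemma measurable_surface_ball r : 0 < r -> measurable (surface_ball D (x0, 0) r).
Proof.
move=> r0; rewrite surface_ballE//; apply: measurableI.
- rewrite -[X in measurable X]setTI; apply: measurable_graph => //.
- by rewrite -[X in measurable X]setTI; apply: measurable_sqdist.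
Qed.

Lemma measurable_boundary : measurable (boundary D).
Proof.
have -> : boundary D = (fun q : R * R => q.2 - phi q.1) @^-1` [set 0].
  apply/seteqP; split => q /=; rewrite (boundary_epigraph _ cphi).
  - by move=> ->; rewrite subrr.
  - by move/eqP; rewrite subr_eq0 => /eqP.
by rewrite -[X in measurable X]setTI; apply: measurable_graph.
Qed.

Lemma harmonic_measure_le (r c : R) : 0 < r ->
  (forall u, perron_family D (bump r) u -> (u X <= c%:E)%E) ->
  (omega (surface_ball D (x0, 0%R) r) <= c%:E)%E.
Proof.
move=> r0 uc; have [_ /(_ _ (bump_boundary_data r r0)) E] := hm.
apply: (@le_trans _ _ (perron_solution D (bump r) X)); last first.
  by apply: ge_ereal_sup => _ [u fu <-]; exact: uc.
rewrite -E.
have -> : omega (surface_ball D (x0, 0) r) =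
    (\int[omega]_(p in boundary D) (\1_(surface_ball D (x0, 0) r) p)%:E)%E.
  rewrite integral_indic; [|exact: measurable_boundary|exact: measurable_surface_ball].
  by congr (omega _); apply/seteqP; split => q [] // [].
apply: ge0_le_integral_nomeas => q _; first by rewrite lee_fin.
rewrite lee_fin indicE; case: (boolP (q \in _)) => [|_]; last exact: bump_ge0.
rewrite inE surface_ballE// => -[_]; rewrite /= in_itv/= => dq.
by rewrite bump_near// ltW.
Qed.

Lemma harmonic_measure_small (e : R) : 0 < e -> exists2 r0, 0 < r0 &
  forall r, 0 < r -> r < r0 -> (omega (surface_ball D (x0, 0%R) r) <= (r * e)%:E)%E.
Proof.
move=> e0.
have X2 : 0 < X.2 := epigraph_snd_gt0 _ phi0 _ DX.
have P0 : 0 < poisson x0 X by exact: poisson_gt0.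
have [d1 d10 thd1] : exists2 d1, 0 < d1 & theta d1 <= 1.
  have : \forall r \near 0^'+, theta r < 1 by apply: (cvgr_lt (0 : R)).
  move=> th1; near (0 : R)^'+ => d1; exists d1 => //.
  by apply/ltW; near: d1.
(* The top scale does not depend on [r]. It ensures [12 rho < delta] and [theta rho <= 1], as
   [perron_step] requires, and is at most the height of the pole, so that [X] lies outside the last
   disc. *)
pose rho := Num.min (Num.min (delta / 13) d1) X.2.
have rho0 : 0 < rho by rewrite !lt_min d10 X2 divr_gt0.
have rhod : rho <= delta / 13 by rewrite !ge_min lexx.
have rho1 : theta rho <= 1.
  by apply: le_trans thd1; apply: theta_mono => //; rewrite !ge_min lexx orbT.
have rhoX : rho ^+ 2 <= sqdist x0 X.
  apply: (@le_trans _ _ (X.2 ^+ 2)); last by rewrite lerDr sqr_ge0.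
  by rewrite lerXn2r ?nnegrE ?(ltW X2) ?(ltW rho0)// !ge_min lexx orbT.
have p64 i : 0 < 64 ^+ i :> R by rewrite exprn_gt0.
(* With this [Q], an exponential factor at most [Q^-1] turns the bound of [perron_iter] at [X] into
   [r * e]. *)
pose Q := 11 * poisson x0 X / e.
have Q0 : 0 < Q by rewrite divr_gt0// mulr_gt0.
have [N HN] := nondini_sum theta theta_pos theta_mono theta_nondini (rho / 64 ^+ 2)
  (128 * 64 * ln Q) (divr_gt0 rho0 (p64 _)).
exists (rho / (8 * 64 ^+ N)); first by rewrite divr_gt0// mulr_gt0.
move=> r r0; rewrite ltr_pdivlMr ?mulr_gt0// => rN.
have r80 : 0 < 8 * r by rewrite mulr_gt0.
have xN : 64 ^+ N <= rho / (8 * r) by rewrite ler_pdivlMr//; lra.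
have [||J /andP[J1 J2]] := @exp_bracket R 64 (rho / (8 * r)) _ _.
- by lra.
- by apply: le_trans xN; rewrite exprn_ege1//; lra.
have NJ : (N <= J)%N.
  rewrite -ltnS -(@ltr_eXn2l R 64); last by lra.
  exact: le_lt_trans xN J2.
rewrite ler_pdivlMr// in J1; rewrite ltr_pdivrMr// in J2.
have iJ i : (i <= J)%N -> 64 ^+ i * (8 * r) <= rho.
  move=> iJ; apply: le_trans J1; rewrite ler_wpM2r ?(ltW r80)//.
  by rewrite ler_weXn2l//; lra.
have sumJ : 128 * 64 * ln Q <= \sum_(i < J) theta (64 ^+ i * (8 * r)).
  (* The scales [64 ^+ i * (8 * r)] rise towards [rho], those of [nondini_sum] descend. After
     reversal, [rho < 64 ^+ J.+1 * (8 * r)] compares them up to two scales, hence the start at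
     [rho / 64 ^+ 2]. *)
  apply: (le_trans (HN _ NJ)); rewrite (reindex_inj rev_ord_inj)/=.
  apply: ler_sum => i _; apply: theta_mono; first by rewrite !divr_gt0.
  rewrite 2?ler_pdivrMr//; apply: (le_trans (ltW J2)).
  rewrite (_ : 64 ^+ J.+1 = 64 ^+ i * 64 ^+ (J - i.+1) * 64 ^+ 2).
    by rewrite le_eqVlt; apply/orP; left; apply/eqP; ring.
  by rewrite -!exprD addn2 -addSn subnKC.
apply: harmonic_measure_le => // u fu.
apply: (@le_trans _ _ (11 * r * expR (- (\sum_(i < J) theta (64 ^+ i * (8 * r))) / (128 * 64))
    * poisson x0 X)%:E).
  apply: (perron_iter phi theta x0 delta cphi phi0 theta_pos theta_mono phi_theta
    (bump r) r r0 (bump_le1 r) _ u J fu _ X DX).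
  - by move=> q dq; apply: bump_far => //; have := sqr_ge0 r; lra.
  - move=> i iltJ; have := iJ i (ltnW iltJ); split; first by lra.
    by apply: le_trans rho1; apply: theta_mono => //; rewrite mulr_gt0.
  - apply: le_trans rhoX; rewrite lerXn2r ?nnegrE ?(ltW rho0) ?iJ//.
    by rewrite mulr_ge0 ?(ltW r80) ?(ltW (p64 _)).
set S := \sum_(i < J) _ in sumJ *.
have expS : expR (- S / (128 * 64)) <= Q^-1.
  apply: (@le_trans _ _ (expR (- ln Q))); first by rewrite ler_expR; lra.
  by rewrite expRN lnK ?posrE.
rewrite lee_fin; apply: (@le_trans _ _ (11 * r * Q^-1 * poisson x0 X)).
  by rewrite ler_wpM2r ?(ltW P0)// ler_wpM2l//; lra.
rewrite le_eqVlt; apply/orP; left; apply/eqP; rewrite /Q; field.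
by rewrite !gt_eqF.
Unshelve. all: by end_near.
Qed.

Lemma zero_density_point : zero_density_set D omega (x0, 0).
Proof.
have small := limf_squeeze0 (density_ratio D omega (x0, 0)).
have [|inf0 sup0] := small _.
  move=> e e0; have [r0 r00 H] := harmonic_measure_small e e0.
  near=> r; have rp : 0 < r by near: r; exact: nbhs_right_gt.
  have rr : r < r0 by near: r; exact: nbhs_right_lt.
  rewrite /density_ratio; apply/andP; split.
    by rewrite mule_ge0// lee_fin invr_ge0 ltW.
  rewrite muleC lee_pdivrMl//.
  by rewrite -EFinM; exact: H.
split => //; apply/(boundary_epigraph _ cphi) => /=.
by rewrite phix0.
Unshelve. all: by end_near.
Qed.

End zero_density.

(** * The domain *)

Section pos.
Context {R : realType}.
Implicit Types (x t h : R).

Lemma is_derive_quadratic (f : R -> R) x (d C : R) : 0 <= C ->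
  (forall h, `|f (x + h) - f x - d * h| <= C * h ^+ 2) -> is_derive x 1 f d.
Proof.
move=> C0 H; suff fd : h^-1 *: (f (h *: 1 + x) - f x) @[h --> 0^'] --> d.
  split; first by apply/cvg_ex; exists d.
  exact/cvg_lim.
apply/cvgrPdist_le => /= e e0; near=> h.
have h0 : h != 0 by near: h; exact: nbhs_dnbhs_neq.
have he : `|h| < e / (C + 1).
  near: h; apply: dnbhs0_lt; rewrite divr_gt0//; lra.
rewrite /GRing.scale/= mulr1 [h + x]addrC.
have -> : d - h^-1 * (f (x + h) - f x) = - (h^-1 * (f (x + h) - f x - d * h)).
  by field.
rewrite normrN normrM normfV mulrC ler_pdivrMr ?normr_gt0//.
apply: (le_trans (H h)); rewrite -(real_normK (num_real h)) expr2 mulrA ler_wpM2r//.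
rewrite ltr_pdivlMr in he; last by lra.
have := normr_ge0 h; nra.
Unshelve. all: by end_near.
Qed.

Lemma near_eq_continuous_at (f g : R -> R) x :
  (\forall y \near x, f y = g y) -> {for x, continuous g} -> {for x, continuous f}.
Proof.
move=> fg; have /= fx := nbhs_singleton fg; rewrite /prop_for /continuous_at fx => cg.
by apply: cvg_trans cg; apply: near_eq_cvg; apply: filterS fg => y ->.
Qed.

(** The square of the positive part is [C^1] and its cube [C^2]; [step] and [round_tent] are splines
    built from these truncated powers. *)
Definition pos_part t : R := Num.max 0 t.

Lemma pos_part_le0 t : t <= 0 -> pos_part t = 0.
Proof. by move=> t0; apply/max_idPl. Qed.

Lemma pos_part_ge0 t : 0 <= t -> pos_part t = t.
Proof. by move=> t0; apply/max_idPr. Qed.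

Lemma continuous_pos_part : continuous pos_part.
Proof. by move=> t; apply: cvg_maxr; [exact: cvg_cst|exact: cvg_id]. Qed.

Lemma is_derive_pos_part2 x : is_derive x 1 (fun t => pos_part t ^+ 2) (2 * pos_part x).
Proof.
apply: (@is_derive_quadratic _ _ _ 1) => // h; rewrite mul1r ler_norml.
have h2 := sqr_ge0 h.
have [x0|x0] := leP x 0; have [xh|xh] := leP (x + h) 0;
  rewrite ?(pos_part_le0 _ x0) ?(pos_part_ge0 _ (ltW x0)) ?(pos_part_le0 _ xh) ?(pos_part_ge0 _ (ltW xh)); nra.
Qed.

Lemma is_derive_pos_part3 x : is_derive x 1 (fun t => pos_part t ^+ 3) (3 * pos_part x ^+ 2).
Proof.
have -> : (fun t => pos_part t ^+ 3) = (fun t => t * pos_part t ^+ 2).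
  apply/funext => t; rewrite exprS; have [t0|t0] := leP t 0.
    by rewrite pos_part_le0// expr0n/= !mulr0.
  by rewrite pos_part_ge0// ltW.
have := is_derive_pos_part2 x => d2.
apply: is_derive_eq; rewrite /GRing.scale/=.
have [x0|x0] := leP x 0; first by rewrite pos_part_le0//; ring.
by rewrite pos_part_ge0 ?ltW//; ring.
Qed.

(** A piecewise quadratic [C^1] passage from [0] to [1]; its derivative is the hat function on
    [[0, 1]] with peak [2]. *)
Definition step t : R := 2 * (pos_part t ^+ 2 - 2 * pos_part (t - 1 / 2) ^+ 2 + pos_part (t - 1) ^+ 2).
Definition dstep t : R := 4 * (pos_part t - 2 * pos_part (t - 1 / 2) + pos_part (t - 1)).

Lemma is_derive_step x : is_derive x 1 step (dstep x).
Proof.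
have dc (c : R) : is_derive x 1 (fun t => pos_part (t - c) ^+ 2) (2 * pos_part (x - c)).
  rewrite -[2 * _]mulr1.
  apply: (@is_derive1_comp _ (fun t => pos_part t ^+ 2) (fun t => t - c)); first exact: is_derive_pos_part2.
  by apply: is_derive_eq; rewrite subr0.
have d0 := is_derive_pos_part2 x.
by apply: is_derive_eq; rewrite /GRing.scale/= /dstep; ring.
Qed.

Lemma continuous_dstep : continuous dstep.
Proof.
have dc (c : R) : continuous (fun t => pos_part (t - c)).
  move=> t; apply: (@continuous_comp _ _ _ (fun t => t - c) pos_part); last exact: continuous_pos_part.
  by apply: cvgB; [exact: cvg_id|exact: cvg_cst].
move=> t; apply: cvgM; first exact: cvg_cst.
apply: cvgD; last exact: dc.
apply: cvgB; first exact: continuous_pos_part.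
by apply: cvgM; [exact: cvg_cst|exact: dc].
Qed.

Lemma step_le0 t : t <= 0 -> step t = 0 /\ dstep t = 0.
Proof. by move=> t0; rewrite /step /dstep !pos_part_le0; try lra; split; ring. Qed.

Lemma step_ge1 t : 1 <= t -> step t = 1 /\ dstep t = 0.
Proof. by move=> t0; rewrite /step /dstep !pos_part_ge0; try lra; split; field. Qed.

Lemma step_bounds t : 0 <= t <= 1 -> 0 <= step t <= 1.
Proof.
move=> /andP[t0 t1]; rewrite /step (pos_part_ge0 _ t0) (pos_part_le0 (t - 1)); last by lra.
have [th|th] := leP t (1 / 2).
  by rewrite pos_part_le0; [apply/andP; split; nra|lra].
by rewrite pos_part_ge0; [apply/andP; split; nra|lra].
Qed.

(* The [C^1] interpolation of [v] at the integers; near [x] it agrees with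
   [piece (floor x)], which joins three consecutive values of [v]. *)
Section spline.
Variable v : int -> R.
Hypothesis v_mono : forall n, v n <= v (n + 1).

Definition piece (n : int) x : R :=
  v (n - 1) + (v n - v (n - 1)) * step (x - (n - 1)%:~R) + (v (n + 1) - v n) * step (x - n%:~R).
Definition dpiece (n : int) x : R :=
  (v n - v (n - 1)) * dstep (x - (n - 1)%:~R) + (v (n + 1) - v n) * dstep (x - n%:~R).

Definition spline x := piece (Num.floor x) x.
Definition dspline x := dpiece (Num.floor x) x.

(** On [[n - 1, n)] the first step of the piece of index [n - 1] is already [1] and the second step
    of the piece of index [n] is still [0], so the two formulas agree. *)
Lemma spline_piece (n : int) x : (n - 1)%:~R <= x < (n + 1)%:~R ->
  spline x = piece n x /\ dspline x = dpiece n x.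
Proof.
move=> /andP[nx xn]; have [n1|n1] := leP n%:~R x.
  by rewrite /spline /dspline (@floor_def _ _ n)// n1.
rewrite /spline /dspline (@floor_def _ _ (n - 1)) ?subrK ?nx ?n1// /piece /dpiece.
rewrite !intrB in nx *; rewrite subrK.
have [-> ->] := step_ge1 (x - (n%:~R - 1%:~R - 1%:~R)) ltac:(lra).
have [-> ->] := step_le0 (x - n%:~R) ltac:(lra).
by split; ring.
Qed.

Lemma near_spline x :
  \forall y \near x, spline y = piece (Num.floor x) y /\ dspline y = dpiece (Num.floor x) y.
Proof.
have /andP[f1 f2] := floor_itv x.
near=> y; apply: spline_piece; apply/andP; split.
  apply: ltW; near: y; apply: lt_nbhsr; rewrite intrB; lra.
by near: y; exact: lt_nbhsl.
Unshelve. all: by end_near.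
Qed.

Lemma is_derive_spline x : is_derive x 1 spline (dspline x).
Proof.
apply: (@near_eq_is_derive _ _ _ (piece (Num.floor x))).
  by near do apply/esym; apply: filterS (near_spline x) => y [].
have dc (c : R) : is_derive x 1 (fun t => step (t - c)) (dstep (x - c)).
  rewrite -[dstep _]mulr1.
  apply: (@is_derive1_comp _ step (fun t => t - c)); first exact: is_derive_step.
  by apply: is_derive_eq; rewrite subr0.
by apply: is_derive_eq; rewrite /GRing.scale/= /dspline /dpiece; ring.
Unshelve. all: by end_near.
Qed.

Lemma continuous_dspline : continuous dspline.
Proof.
move=> x; apply: (@near_eq_continuous_at _ (dpiece (Num.floor x))).
  by apply: filterS (near_spline x) => y [].
have dc (c : R) : continuous (fun t => dstep (t - c)).
  move=> t; apply: (@continuous_comp _ _ _ (fun t => t - c) dstep); last exact: continuous_dstep.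
  by apply: cvgB; [exact: cvg_id|exact: cvg_cst].
by apply: cvgD; apply: cvgM; (try exact: cvg_cst); exact: dc.
Qed.

Lemma spline_bounds x : v (Num.floor x) <= spline x <= v (Num.floor x + 1).
Proof.
have /andP[f1 f2] := floor_itv x; rewrite /spline /piece.
set n := Num.floor x in f1 f2 *; rewrite !intrD in f2 *.
have [-> _] := step_ge1 (x - (n%:~R + (-1)%:~R)) ltac:(lra).
have /andP[] := step_bounds (x - n%:~R) ltac:(apply/andP; split; lra).
have := v_mono n; nra.
Qed.

End spline.

End pos.

(** * The smooth profile [g] and its antiderivative *)

Section profile.
Context {R : realType}.

(** The values of [theta] along a geometric progression are joined by the spline in the variable
    [ln x], which stays between consecutive values even where [theta] jumps. *)
Lemma smooth_between (theta : R -> R) :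
  (forall r : R, 0 < r -> 0 < theta r) ->
  (forall r s : R, 0 < r -> r <= s -> theta r <= theta s) ->
  theta r @[r --> 0^'+] --> (0 : R) ->
  exists g dg : R -> R, [/\ forall x, x <= 0 -> g x = 0,
    forall x, 0 < x -> theta (2 * x) <= g x <= theta (4 * x),
    forall x : R, 0 < x -> is_derive x 1 g (dg x) /\ {for x, continuous dg}
    & continuous g].
Proof.
move=> tpos tmono tlim.
(* The mesh has ratio [sqrt 2]: the interpolation looks back at most two mesh steps, a factor [2],
   and the shift by one in [v] keeps it from looking beyond [4 * x]. *)
pose h : R := ln 2 / 2.
have ln20 : 0 < ln 2 :> R by rewrite ln_gt0// ltr1n.
have h0 : 0 < h by rewrite divr_gt0.
have e2h : expR (2 * h) = 2 by rewrite /h mulrC divfK// lnK// posrE.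
pose v (n : int) := theta (4 * expR ((n - 1)%:~R * h)).
have v_mono n : v n <= v (n + 1).
  apply: tmono; first by rewrite mulr_gt0 ?expR_gt0.
  rewrite ler_pM2l// ler_expR ler_pM2r// ler_int; lia.
pose y x := ln x / h.
pose g x := if x <= 0 then 0 else spline v (y x).
pose dg x := dspline v (y x) * (x^-1 / h).
have gpos x : 0 < x -> theta (2 * x) <= g x <= theta (4 * x).
  move=> x0; have -> : g x = spline v (y x) by rewrite /g leNgt x0.
  have /andP[s1 s2] := spline_bounds v v_mono (y x).
  have /andP[f1 f2] := floor_itv (y x).
  have xE : x = expR (y x * h) by rewrite /y divfK ?gt_eqF// lnK.
  apply/andP; split; [apply: le_trans s1|apply: (le_trans s2)]; apply: tmono.
  - by rewrite mulr_gt0.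
  - rewrite [in leLHS]xE (_ : 4 * _ = 2 * (expR (2 * h) * expR ((Num.floor (y x) - 1)%:~R * h))).
      rewrite ler_pM2l// -expRD ler_expR -mulrDl ler_pM2r//.
      by rewrite intrB; rewrite intrD in f2; lra.
    by rewrite e2h; ring.
  - by rewrite mulr_gt0 ?expR_gt0.
  - by rewrite ler_pM2l// addrK [in leRHS]xE ler_expR ler_pM2r.
have g0 x : x <= 0 -> g x = 0 by rewrite /g => ->.
have gge0 x : 0 <= g x.
  have [/g0 ->//|x0] := leP x 0; have /andP[+ _] := gpos _ x0; apply: le_trans.
  by rewrite ltW// tpos// mulr_gt0.
have dgP (x : R) : 0 < x -> is_derive x 1 g (dg x).
  move=> x0; apply: (@near_eq_is_derive _ _ _ (spline v \o y)).
    near=> z; rewrite /g leNgt (_ : 0 < z)//; near: z; exact: lt_nbhsr.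
  have dy : is_derive x 1 y (x^-1 / h).
    rewrite /y; have dl := is_derive1_ln x0.
    by apply: is_derive_eq; rewrite /GRing.scale/=; ring.
  apply: (@is_derive1_comp _ (spline v) y); exact: is_derive_spline.
exists g, dg; split => // x.
- move=> x0; split; first exact: dgP.
  apply: cvgM; last first.
    apply: cvgM; last exact: cvg_cst.
    by apply: cvgV; [exact: lt0r_neq0|exact: cvg_id].
  apply: (@continuous_comp _ _ _ y (dspline v)); last exact: continuous_dspline.
  by apply: cvgM; [exact: continuous_ln|exact: cvg_cst].
- have [x0|x0|->] := ltgtP x 0.
  + apply: (@near_eq_continuous_at _ _ (cst 0)); last exact: cst_continuous.
    by near=> z; rewrite g0//; apply: ltW; near: z; exact: lt_nbhsl.
  + apply: differentiable_continuous; apply/derivable1_diffP.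
    by apply: ex_derive; exact: dgP.
  + apply/cvgrPdist_le => /= e e0; rewrite g0// .
    have /cvgrPdist_le/(_ e e0) := tlim; rewrite near_withinE => /nbhs_ballP[d /= d0 H].
    have nd : \forall z \near (0 : R), `|z| < d / 4 by apply: nbhs0_lt; rewrite divr_gt0.
    apply: filterS nd => z zd; rewrite sub0r normrN (ger0_norm (gge0 _)).
    have [z0|z0] := leP z 0; first by rewrite g0// ltW.
    have /andP[_ /le_trans] := gpos _ z0; apply.
    have : `|0 - theta (4 * z)| <= e.
      apply: H; last by rewrite mulr_gt0.
      rewrite /ball/= sub0r normrN gtr0_norm ?mulr_gt0//.
      by rewrite gtr0_norm// in zd; lra.
    by rewrite sub0r normrN; apply: le_trans; exact: ler_norm.
Unshelve. all: by end_near.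
Qed.

Lemma antiderivative (f : R -> R) : continuous f -> (forall x, x <= 0 -> f x = 0) ->
  exists2 F : R -> R, (forall x : R, is_derive x 1 F (f x)) & forall x, x <= 0 -> F x = 0.
Proof.
move=> cf f0.
(* Starting at [-1] makes every [x >= 0] interior to the interval of integration, so that the
   fundamental theorem also covers [x = 0]. *)
pose F x := (\int[lebesgue_measure]_(t in [set` `[-1, x]]) (f t))%R.
have F0 x : x <= 0 -> F x = 0.
  move=> x0; rewrite /F /Rintegral integral0_eq// => t /=.
  by rewrite in_itv/= => /andP[_ tx]; rewrite f0// (le_trans tx).
exists F => // x; have [x0|x0] := ltP x 0.
  rewrite f0 ?ltW//; apply: (@near_eq_is_derive _ _ _ (cst 0)).
    near=> z; rewrite F0//; apply: ltW; near: z; exact: lt_nbhsl.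
have xx : x < x + 1 by rewrite ltrDl.
have xN1 : -1 < x by lra.
have [|dF F'] := @continuous_FTC1_closed R f (-1) x (x + 1) xx _ xN1 (cf x).
  apply: continuous_compact_integrable; first exact: segment_compact.
  exact: continuous_subspaceT.
by rewrite -F' derive1E; exact: derivableP.
Unshelve. all: by end_near.
Qed.

End profile.

Section local_smoothness.
Context {R : realType}.
Implicit Types (f F : R -> R) (x y : R) (U : set R).

Lemma C1_local f F F1 U : open U -> (forall y, U y -> f y = F y) ->
  (forall y : R, U y -> is_derive y 1 F (F1 y)) ->
  forall y, U y -> derivable f y 1 /\ derive1 f y = F1 y.
Proof.
move=> oU fF dF y Uy; have df : is_derive y 1 f (F1 y).
  apply: (@near_eq_is_derive _ _ _ F); last exact: dF.
  by apply: filterS (open_nbhs_nbhs (conj oU Uy)) => z /fF ->.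
by split; [exact: ex_derive|rewrite derive1E derive_val].
Qed.

Lemma C1_local_continuous f F F1 U : open U -> (forall y, U y -> f y = F y) ->
  (forall y : R, U y -> is_derive y 1 F (F1 y)) ->
  forall y, U y -> {for y, continuous F1} -> {for y, continuous (derive1 f)}.
Proof.
move=> oU fF dF y Uy; apply: near_eq_continuous_at.
apply: filterS (open_nbhs_nbhs (conj oU Uy)) => z Uz.
exact: (C1_local f F F1 U oU fF dF z Uz).2.
Qed.

Lemma C2_local f F F1 F2 U : open U -> (forall y, U y -> f y = F y) ->
  (forall y : R, U y -> is_derive y 1 F (F1 y)) ->
  (forall y : R, U y -> is_derive y 1 F1 (F2 y)) ->
  (forall y, U y -> {for y, continuous F2}) -> C2_on f U.
Proof.
move=> oU fF dF dF1 cF2 y Uy.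
have f'F1 z : U z -> derive1 f z = F1 z by move=> Uz; exact: (C1_local f F F1 U oU fF dF z Uz).2.
split; first exact: (C1_local f F F1 U oU fF dF y Uy).1.
  exact: (C1_local _ F1 F2 U oU f'F1 dF1 y Uy).1.
by apply: (C1_local_continuous _ F1 F2 U oU f'F1 dF1 y Uy); exact: cF2.
Qed.

End local_smoothness.

Section tent.
Context {R : realType}.
Implicit Types t : R.

(* A [C^2] rounding of the tent [min t (1 - t)], unchanged where
   [t <= 1/4] or [3/4 <= t]. *)
Definition round_tent t : R :=
  t - 16 / 3 * (pos_part (t - 1 / 4) ^+ 3 - 2 * pos_part (t - 1 / 2) ^+ 3 + pos_part (t - 3 / 4) ^+ 3).
Definition dround_tent t : R :=
  1 - 16 * (pos_part (t - 1 / 4) ^+ 2 - 2 * pos_part (t - 1 / 2) ^+ 2 + pos_part (t - 3 / 4) ^+ 2).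
Definition ddround_tent t : R :=
  - 32 * (pos_part (t - 1 / 4) - 2 * pos_part (t - 1 / 2) + pos_part (t - 3 / 4)).

Lemma is_derive_round_tent t : is_derive t 1 round_tent (dround_tent t).
Proof.
have dc (c : R) : is_derive t 1 (fun t => pos_part (t - c) ^+ 3) (3 * pos_part (t - c) ^+ 2).
  rewrite -[3 * _]mulr1.
  apply: (@is_derive1_comp _ (fun t => pos_part t ^+ 3) (fun t => t - c)); first exact: is_derive_pos_part3.
  by apply: is_derive_eq; rewrite subr0.
by apply: is_derive_eq; rewrite /GRing.scale/= /dround_tent; field.
Qed.

Lemma is_derive_dround_tent t : is_derive t 1 dround_tent (ddround_tent t).
Proof.
have dc (c : R) : is_derive t 1 (fun t => pos_part (t - c) ^+ 2) (2 * pos_part (t - c)).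
  rewrite -[2 * _]mulr1.
  apply: (@is_derive1_comp _ (fun t => pos_part t ^+ 2) (fun t => t - c)); first exact: is_derive_pos_part2.
  by apply: is_derive_eq; rewrite subr0.
by apply: is_derive_eq; rewrite /GRing.scale/= /ddround_tent; field.
Qed.

Lemma continuous_ddround_tent : continuous ddround_tent.
Proof.
have dc (c : R) : continuous (fun t => pos_part (t - c)).
  move=> t; apply: (@continuous_comp _ _ _ (fun t => t - c) pos_part); last exact: continuous_pos_part.
  by apply: cvgB; [exact: cvg_id|exact: cvg_cst].
move=> t; apply: cvgM; first exact: cvg_cst.
apply: cvgD; last exact: dc.
by apply: cvgB; [exact: dc|apply: cvgM; [exact: cvg_cst|exact: dc]].
Qed.

Lemma round_tent_left t : t <= 1 / 4 -> round_tent t = t /\ dround_tent t = 1.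
Proof. by move=> t0; rewrite /round_tent /dround_tent !pos_part_le0; try lra; split; ring. Qed.

Lemma round_tent_right t : 3 / 4 <= t -> round_tent t = 1 - t /\ dround_tent t = -1.
Proof. by move=> t0; rewrite /round_tent /dround_tent !pos_part_ge0; try lra; split; field. Qed.

(** Positivity keeps the argument of [g] where [g] is [C^1]; the other bounds make the rounded
    distance at most the true one, with slope at most [1], so that rounding does not break the upper
    bound on the modulus. *)
Lemma round_tent_bounds t : 0 < t < 1 ->
  [/\ 0 < round_tent t, round_tent t <= t, round_tent t <= 1 - t & -1 <= dround_tent t <= 1].
Proof.
move=> /andP[t0 t1].
have [t2|t2] := leP t (1 / 4).
  by have [-> ->] := round_tent_left _ t2; split; try lra; apply/andP; split; lra.
have [t3|t3] := leP (3 / 4) t.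
  by have [-> ->] := round_tent_right _ t3; split; try lra; apply/andP; split; lra.
rewrite /round_tent /dround_tent (pos_part_ge0 (t - 1 / 4)) ?(pos_part_le0 (t - 3 / 4)); try lra.
have [t4|t4] := leP t (1 / 2).
  rewrite (pos_part_le0 (t - 1 / 2)); last by lra.
  pose u := t - 1 / 4; have -> : t = u + 1 / 4 by rewrite /u; ring.
  have u0 : 0 <= u by rewrite /u; lra.
  have u1 : u <= 1 / 4 by rewrite /u; lra.
  have -> : u + 1 / 4 - 1 / 4 = u by ring.
  have uu : u ^+ 2 <= 1 / 16 by nra.
  have uu0 := sqr_ge0 u.
  have u30 : 0 <= u ^+ 3 by exact: exprn_ge0.
  have u3 : u ^+ 3 <= 1 / 16 * u by rewrite exprSr; nra.
  by rewrite !expr0n/=; split; try lra; apply/andP; split; lra.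
rewrite (pos_part_ge0 (t - 1 / 2)); last by lra.
pose u := 3 / 4 - t; have -> : t = 3 / 4 - u by rewrite /u; ring.
have u0 : 0 <= u by rewrite /u; lra.
have u1 : u <= 1 / 4 by rewrite /u; lra.
have uu : u ^+ 2 <= 1 / 16 by nra.
have uu0 := sqr_ge0 u.
have u30 : 0 <= u ^+ 3 by exact: exprn_ge0.
have u3 : u ^+ 3 <= 1 / 16 * u by rewrite exprSr; nra.
rewrite !expr0n/= !addr0.
have -> : 3 / 4 - u - 16 / 3 * ((3 / 4 - u - 1 / 4) ^+ 3 - 2 * (3 / 4 - u - 1 / 2) ^+ 3) =
  1 / 4 + u - 16 / 3 * u ^+ 3 by field.
have -> : 1 - 16 * ((3 / 4 - u - 1 / 4) ^+ 2 - 2 * (3 / 4 - u - 1 / 2) ^+ 2) = -1 + 16 * u ^+ 2 by field.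
by split; try lra; apply/andP; split; lra.
Qed.

End tent.

(** * The function [phi] and the modulus of continuity of its derivative *)

Section construction.
Context {R : realType}.
Variables (theta g dg Phi : R -> R).
Hypothesis theta_pos : forall r : R, 0 < r -> 0 < theta r.
Hypothesis theta_mono : forall r s : R, 0 < r -> r <= s -> theta r <= theta s.
Hypothesis theta_lim0 : theta r @[r --> 0^'+] --> (0 : R).
Hypothesis g_le0 : forall x, x <= 0 -> g x = 0.
Hypothesis g_theta : forall x, 0 < x -> theta (2 * x) <= g x <= theta (4 * x).
Hypothesis g_C1 : forall x : R, 0 < x -> is_derive x 1 g (dg x) /\ {for x, continuous dg}.
Hypothesis cg : continuous g.
Hypothesis Phi_derive : forall x : R, is_derive x 1 Phi (g x).
Hypothesis Phi_le0 : forall x, x <= 0 -> Phi x = 0.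
Implicit Types (x y r : R) (k : nat).

Lemma Phi_MVT x y : x < y -> exists2 c, x < c < y & Phi y - Phi x = g c * (y - x).
Proof.
move=> xy; have [|c /[!in_itv]/= cxy E] := MVT xy (fun z _ => Phi_derive z).
  by apply: derivable_within_continuous => z _; apply: ex_derive.
by exists c.
Qed.

Lemma g_ge0 x : 0 <= g x.
Proof.
have [/g_le0 ->//|x0] := leP x 0; have /andP[+ _] := g_theta _ x0; apply: le_trans.
by rewrite ltW// theta_pos// mulr_gt0.
Qed.

Lemma Phi_mono x y : x <= y -> Phi x <= Phi y.
Proof.
rewrite le_eqVlt => /predU1P[->//|xy]; have [c _ E] := Phi_MVT _ _ xy.
by rewrite -subr_ge0 E mulr_ge0 ?g_ge0// subr_ge0 ltW.
Qed.

Lemma Phi_ge0 x : 0 <= Phi x.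
Proof.
have [/Phi_le0 ->//|x0] := leP x 0.
by rewrite -(Phi_le0 0 (lexx 0)) Phi_mono// ltW.
Qed.

Lemma Phi_upper x : 0 < x -> Phi x <= x * theta (4 * x).
Proof.
move=> x0; have [c /andP[c0 cx]] := Phi_MVT _ _ x0.
rewrite (Phi_le0 0)// !subr0 => ->; rewrite mulrC ler_wpM2l ?(ltW x0)//.
have /andP[_ /le_trans] := g_theta _ c0; apply; apply: theta_mono; lra.
Qed.

(** Only [[x / 2, x]] is used: there [2 * c >= x], hence [g c >= theta x]. *)
Lemma Phi_lower x : 0 < x -> x / 2 * theta x <= Phi x.
Proof.
move=> x0; have xx : x / 2 < x by lra.
have [c /andP[c0 cx] E] := Phi_MVT _ _ xx.
have := Phi_ge0 (x / 2); have c1 : 0 < c by lra.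
have /andP[g1 _] := g_theta _ c1.
have : theta x <= g c by apply: le_trans g1; apply: theta_mono => //; lra.
have := theta_pos _ x0; nra.
Qed.

(** With ratio [16] a quarter of the gap to the right of [xs k.+1] is longer than [3 * xs k.+1], so
    [phi] is not rounded before [4 * xs k.+1]; see [phi_right] and [modulus_phi]. *)
Definition xs k : R := (16 ^+ k)^-1.

Lemma xs_gt0 k : 0 < xs k.
Proof. by rewrite invr_gt0 exprn_gt0. Qed.

Lemma xsS k : xs k = 16 * xs k.+1.
Proof. by rewrite /xs exprS invfM mulrA divff ?mul1r. Qed.

Lemma xs0 : xs 0 = 1.
Proof. by rewrite /xs expr0 invr1. Qed.

Lemma le_xs j k : (j <= k)%N -> xs k <= xs j.
Proof.
move=> jk; rewrite /xs lef_pV2 ?posrE ?exprn_gt0//.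
by rewrite ler_weXn2l//; lra.
Qed.

Lemma xs_lt j k : xs k < xs j -> (j < k)%N.
Proof. by move=> H; rewrite ltnNge; apply/negP => /le_xs; lra. Qed.

Lemma xs_bracket x : 0 < x <= 1 -> exists k, xs k.+1 < x <= xs k.
Proof.
move=> /andP[x0 x1]; have [||n /andP[n1 n2]] := @exp_bracket R 16 x^-1 _ _.
- by lra.
- by rewrite -invr1 lef_pV2 ?posrE.
exists n; rewrite /xs; apply/andP; split.
  by rewrite -[ltRHS]invrK ltf_pV2 ?posrE ?invr_gt0 ?exprn_gt0.
by rewrite -[leLHS]invrK lef_pV2 ?posrE ?invr_gt0 ?exprn_gt0.
Qed.

Lemma xs_bracket_inj x j k : xs j.+1 < x <= xs j -> xs k.+1 < x <= xs k -> j = k.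
Proof.
move=> /andP[j1 j2] /andP[k1 k2]; apply/eqP; rewrite eqn_leq.
by rewrite -ltnS (xs_lt _ _ (lt_le_trans k1 j2))/= -ltnS (xs_lt _ _ (lt_le_trans j1 k2)).
Qed.

Definition gaplen k : R := 15 * xs k.+1.

Lemma gaplen_gt0 k : 0 < gaplen k.
Proof. by rewrite mulr_gt0 ?xs_gt0. Qed.

Definition tau k x : R := gaplen k * round_tent ((x - xs k.+1) / gaplen k).

(* [phi] is [Phi] of the distance to [0] and the points [xs k], rounded off
   near the midpoints of the gaps. *)
Definition phi x : R :=
  if x <= 0 then Phi (- x) else if 1 < x then Phi (x - 1)
  else Phi (tau (xget 0%N [set k | xs k.+1 < x <= xs k]) x).

Lemma phi_neg x : x <= 0 -> phi x = Phi (- x).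
Proof. by move=> x0; rewrite /phi x0. Qed.

Lemma phi_gap_half_open k x : xs k.+1 < x <= xs k -> phi x = Phi (tau k x).
Proof.
move=> xk; have x0 : 0 < x by have /andP[+ _] := xk; apply: lt_trans; exact: xs_gt0.
have x1 : x <= 1 by have /andP[_ /le_trans] := xk; apply; rewrite -xs0 le_xs.
rewrite /phi leNgt x0/= ltNge x1/=; congr (Phi (tau _ _)).
case: xgetP => [j _ /= xj|/(_ k)]; last by rewrite /= xk.
exact: (xs_bracket_inj x).
Qed.

Lemma tau_left k x : x - xs k.+1 <= gaplen k / 4 -> tau k x = x - xs k.+1.
Proof.
move=> xk; rewrite /tau; have [|-> _] := round_tent_left ((x - xs k.+1) / gaplen k).
  by rewrite ler_pdivrMr ?gaplen_gt0//; lra.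
by rewrite mulrC divfK// gt_eqF ?gaplen_gt0.
Qed.

Lemma tau_right k x : xs k - x <= gaplen k / 4 -> tau k x = xs k - x.
Proof.
move=> xk; have E := xsS k; have L0 := gaplen_gt0 k; rewrite /tau.
have [|-> _] := round_tent_right ((x - xs k.+1) / gaplen k).
  by rewrite ler_pdivlMr//; rewrite /gaplen in xk L0 *; lra.
rewrite mulrBr mulr1 [_ * (_ / _)]mulrC divfK ?gt_eqF// E /gaplen; ring.
Qed.

Lemma phi_gap k x : xs k.+1 <= x <= xs k -> phi x = Phi (tau k x).
Proof.
move=> /andP[]; rewrite le_eqVlt => /predU1P[<-|k1 k2]; last by apply: phi_gap_half_open; rewrite k1.
move=> _; rewrite tau_left; last by rewrite subrr divr_ge0// ltW// gaplen_gt0.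
have E := xsS k.+1; have := xs_gt0 k.+2 => x0.
rewrite (phi_gap_half_open k.+1) ?lexx ?andbT; last by lra.
by rewrite tau_right ?subrr ?divr_ge0// ltW// gaplen_gt0.
Qed.

Lemma phi_big x : 1 <= x -> phi x = Phi (x - 1).
Proof.
rewrite le_eqVlt => /predU1P[<-|x1]; last first.
  by rewrite /phi leNgt x1 (lt_trans ltr01 x1).
have E := xsS 0; rewrite xs0 in E.
rewrite (phi_gap 0) ?xs0 ?lexx ?andbT; last by lra.
by rewrite tau_right xs0 subrr// divr_ge0// ltW// gaplen_gt0.
Qed.

Lemma phi_right k x : xs k <= x <= 4 * xs k -> phi x = Phi (x - xs k).
Proof.
case: k => [|k] /andP[k1 k2]; first by rewrite xs0 in k1 *; exact: phi_big.
have E := xsS k; have x0 := xs_gt0 k.+1.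
rewrite (phi_gap k) ?tau_left//; first by rewrite /gaplen; lra.
by apply/andP; split; lra.
Qed.

Lemma phi_left k x : 7 / 8 * xs k <= x <= xs k -> phi x = Phi (xs k - x).
Proof.
move=> /andP[k1 k2]; have E := xsS k; have x0 := xs_gt0 k.+1.
rewrite (phi_gap k) ?tau_right//; first by rewrite /gaplen; lra.
by apply/andP; split; lra.
Qed.

(** As [Phi] vanishes on negative numbers, the sum is [Phi] of the distance to [xs k], in a form
    that can be differentiated across [xs k]. *)
Lemma phi_near_xs k x : 7 / 8 * xs k < x < 9 / 8 * xs k ->
  phi x = Phi (x - xs k) + Phi (xs k - x).
Proof.
move=> /andP[k1 k2]; have x0 := xs_gt0 k; have [xk|xk] := leP x (xs k).
  by rewrite (phi_left k) ?(Phi_le0 (x - xs k)) ?add0r//; [lra|rewrite xk andbT; lra].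
by rewrite (phi_right k) ?(Phi_le0 (xs k - x)) ?addr0//; [lra|apply/andP; split; lra].
Qed.

Lemma phi_ge0 x : 0 <= phi x.
Proof. by rewrite /phi; case: ifP => _; [|case: ifP => _]; exact: Phi_ge0. Qed.

Lemma phi_xs k : phi (xs k) = 0.
Proof.
have x0 := xs_gt0 k; rewrite (phi_right k); last by apply/andP; split; lra.
by rewrite subrr Phi_le0.
Qed.

Lemma phi_comp (U : set R) (t dt ddt : R -> R) : open U ->
  (forall y, U y -> phi y = Phi (t y)) -> (forall y, U y -> 0 < t y) ->
  (forall y : R, U y -> is_derive y 1 t (dt y)) ->
  (forall y : R, U y -> is_derive y 1 dt (ddt y)) ->
  (forall y, U y -> {for y, continuous ddt}) ->
  C2_on phi U /\ forall y, U y -> derive1 phi y = g (t y) * dt y.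
Proof.
move=> oU phiE t0 tD dtD cddt.
have D1 (y : R) : U y -> is_derive y 1 (fun z => Phi (t z)) (g (t y) * dt y).
  by move=> Uy; apply: (@is_derive1_comp _ Phi t); exact: tD.
have Dg (y : R) : U y -> is_derive y 1 (fun z => g (t z)) (dg (t y) * dt y).
  by move=> Uy; have [? _] := g_C1 _ (t0 _ Uy); apply: (@is_derive1_comp _ g t); exact: tD.
have D2 (y : R) : U y -> is_derive y 1 (fun z => g (t z) * dt z)
    (dg (t y) * dt y * dt y + g (t y) * ddt y).
  move=> Uy; have h1 := Dg _ Uy; have h2 := dtD _ Uy.
  by apply: is_derive_eq; rewrite /GRing.scale/=; ring.
split; last by move=> y Uy; have [] := C1_local _ _ _ _ oU phiE D1 y Uy.
apply: (C2_local _ _ _ _ _ oU phiE D1 D2) => y Uy.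
have ct : {for y, continuous t}.
  by apply: differentiable_continuous; apply/derivable1_diffP; apply: ex_derive; exact: tD.
have cdt : {for y, continuous dt}.
  by apply: differentiable_continuous; apply/derivable1_diffP; apply: ex_derive; exact: dtD.
have cgt : {for y, continuous (fun z => g (t z))}.
  by apply: (@continuous_comp _ _ _ t g) => //; exact: cg.
have cdgt : {for y, continuous (fun z => dg (t z))}.
  by apply: (@continuous_comp _ _ _ t dg) => //; exact: (g_C1 _ (t0 _ Uy)).2.
apply: cvgD; last by apply: cvgM => //; exact: cddt.
by apply: cvgM => //; exact: cvgM.
Qed.

(** In the second part [t] is at most the distance from [x] to the closure of the set of the [xs k];
    this is how the derivative is bounded in [derive1_phi_le]. *)
Definition regular_at x : Prop :=
  (exists U : set R, [/\ open U, U x & C2_on phi U]) /\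
  exists t d, [/\ 0 < t, -1 <= d <= 1, derive1 phi x = g t * d,
    forall k, t <= `|x - xs k| & t <= `|x|].

Lemma phi_regular_neg x : x < 0 -> regular_at x.
Proof.
move=> x0; have [] : C2_on phi [set y | y < 0] /\ forall y, y < 0 -> derive1 phi y = g (- y) * -1.
  apply: (phi_comp [set y | y < 0] -%R (cst (-1)) (cst 0)).
- exact: open_lt.
- by move=> y /= y0; rewrite phi_neg// ltW.
- by move=> y /=; rewrite oppr_gt0.
- by move=> y _; exact: cst_continuous.
move=> C2 D1; split; first by exists [set y | y < 0]; split => //; exact: open_lt.
exists (- x), (-1); split.
- by rewrite oppr_gt0.
- by apply/andP; split; lra.
- by rewrite D1.
- by move=> k; have s0 := xs_gt0 k; rewrite ltr0_norm; lra.
- by rewrite ltr0_norm.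
Qed.

Lemma phi_regular_big x : 1 < x -> regular_at x.
Proof.
move=> x1; have [] : C2_on phi [set y | 1 < y] /\ forall y, 1 < y -> derive1 phi y = g (y - 1) * 1.
  apply: (phi_comp [set y | 1 < y] (fun y => y - 1) (cst 1) (cst 0)).
- exact: open_gt.
- by move=> y /= y0; rewrite phi_big// ltW.
- by move=> y /=; rewrite subr_gt0.
- by move=> y _; apply: is_derive_eq; rewrite subr0.
- by move=> y _; exact: cst_continuous.
move=> C2 D1; split; first by exists [set y | 1 < y]; split => //; exact: open_gt.
exists (x - 1), 1; split.
- by rewrite subr_gt0.
- by apply/andP; split; lra.
- by rewrite D1.
- move=> k; have := le_xs _ _ (leq0n k); rewrite xs0 => xk.
  by rewrite ger0_norm; lra.
- by rewrite ger0_norm; lra.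
Qed.

Lemma phi_regular_gap k x : xs k.+1 < x < xs k -> regular_at x.
Proof.
move=> xk; have L0 := gaplen_gt0 k; have E := xsS k; have s0 := xs_gt0 k.+1.
pose a y := (y - xs k.+1) / gaplen k.
have a01 y : xs k.+1 < y < xs k -> 0 < a y < 1.
  move=> /andP[y1 y2]; rewrite /a ltr_pdivrMr// divr_gt0 ?subr_gt0//=.
  by rewrite /gaplen; lra.
have da (y : R) : is_derive y 1 a (gaplen k)^-1.
  by rewrite /a; apply: is_derive_eq; rewrite /GRing.scale/=; ring.
pose U := [set` `]xs k.+1, xs k[] : set R.
have oU : open U by exact: itv_open.
have UE y : U y = (xs k.+1 < y < xs k) :> Prop by rewrite /U/= in_itv.
have [] : C2_on phi U /\ forall y, U y -> derive1 phi y = g (tau k y) * dround_tent (a y).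
  apply: (phi_comp U (tau k) (fun y => dround_tent (a y)) (fun y => ddround_tent (a y) / gaplen k)).
- exact: oU.
- by move=> y; rewrite UE => /andP[y1 y2]; rewrite (phi_gap k)// !ltW.
- by move=> y; rewrite UE => /a01/round_tent_bounds[r0 _ _ _]; rewrite mulr_gt0.
- move=> y _; have h : is_derive y 1 (fun z => round_tent (a z)) (dround_tent (a y) / gaplen k).
    exact: (@is_derive1_comp R round_tent a y _ _ (is_derive_round_tent (a y)) (da y)).
  rewrite /tau; apply: is_derive_eq; rewrite /GRing.scale/=.
  by rewrite mulrCA divff ?mulr1// gt_eqF.
- by move=> y _; exact: (@is_derive1_comp R dround_tent a y _ _ (is_derive_dround_tent (a y)) (da y)).
- move=> y _; apply: cvgM; last exact: cvg_cst.
  apply: (@continuous_comp _ _ _ a ddround_tent); last exact: continuous_ddround_tent.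
  by apply: differentiable_continuous; apply/derivable1_diffP; apply: ex_derive.
have Ux : U x by rewrite UE.
move=> C2 D1; split; first by exists U.
have /andP[x1 x2] := xk.
have [r0 r1 r2 r3] := round_tent_bounds _ (a01 _ xk).
have La : gaplen k * a x = x - xs k.+1 by rewrite /a mulrC divfK// gt_eqF.
have t1 : tau k x <= x - xs k.+1 by rewrite -La ler_wpM2l// ltW.
have t2 : tau k x <= xs k - x.
  apply: (le_trans (ler_wpM2l (ltW L0) r2)).
  have -> : gaplen k * (1 - a x) = gaplen k - (x - xs k.+1) by rewrite -La; ring.
  by rewrite /gaplen; lra.
exists (tau k x), (dround_tent (a x)); split => //.
- by rewrite mulr_gt0.
- exact: D1.
- move=> j; have [/le_xs jk|/le_xs kj] := leqP j k.
    by rewrite ler0_norm; lra.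
  by rewrite ger0_norm; lra.
- by rewrite ger0_norm; lra.
Qed.

Lemma phi_regular x : x != 0 -> (forall k, x != xs k) -> regular_at x.
Proof.
move=> xn0 xnk; have [x0|x0] := ltP x 0; first exact: phi_regular_neg.
have {xn0}x0 : 0 < x by rewrite lt_neqAle eq_sym xn0.
have [x1|x1] := leP x 1; last exact: phi_regular_big.
have [k /andP[k1 k2]] := xs_bracket _ (introT andP (conj x0 x1)).
by apply: (phi_regular_gap k); rewrite k1 lt_neqAle xnk.
Qed.

Lemma derive1_phi_xs k : derivable phi (xs k) 1 /\ derive1 phi (xs k) = 0
  /\ {for xs k, continuous (derive1 phi)}.
Proof.
pose U := [set` `]7 / 8 * xs k, 9 / 8 * xs k[] : set R.
have oU : open U by exact: itv_open.
have x0 := xs_gt0 k.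
have Ux : U (xs k) by rewrite /U/= in_itv/=; apply/andP; split; lra.
have phiE y : U y -> phi y = Phi (y - xs k) + Phi (xs k - y).
  by rewrite /U/= in_itv/=; exact: phi_near_xs.
have D1 (y : R) : U y -> is_derive y 1 (fun y => Phi (y - xs k) + Phi (xs k - y))
    (g (y - xs k) - g (xs k - y)).
  move=> _.
  have d1 : is_derive y 1 (fun y => Phi (y - xs k)) (g (y - xs k)).
    rewrite -[g _]mulr1; apply: (@is_derive1_comp _ Phi (fun y => y - xs k)).
    by apply: is_derive_eq; rewrite subr0.
  have d2 : is_derive y 1 (fun y => Phi (xs k - y)) (g (xs k - y) * -1).
    apply: (@is_derive1_comp _ Phi (fun y => xs k - y)).
    have := is_deriveB (is_derive_cst (xs k) y (1 : R)) (is_derive_id y (1 : R)).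
    by rewrite sub0r; exact.
  by apply: is_derive_eq; rewrite mulrN1.
have [h1 h2] := C1_local _ _ _ _ oU phiE D1 _ Ux.
split; first exact: h1.
split; first by rewrite h2; exact: subrr.
apply: (C1_local_continuous _ _ _ _ oU phiE D1 _ Ux).
apply: cvgB.
  apply: (@continuous_comp _ _ _ (fun y => y - xs k) g); last exact: cg.
  by apply: cvgB; [exact: cvg_id|exact: cvg_cst].
apply: (@continuous_comp _ _ _ (fun y => xs k - y) g); last exact: cg.
by apply: cvgB; [exact: cvg_cst|exact: cvg_id].
Qed.

Lemma theta_small (e : R) : 0 < e -> exists2 d, 0 < d & forall r, 0 < r -> r < d -> theta (4 * r) <= e.
Proof.
move=> e0; have /cvgrPdist_le/(_ e e0) := theta_lim0.
rewrite near_withinE => /nbhs_ballP[d /= d0 H].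
exists (d / 4) => [|r r0 rd]; first by rewrite divr_gt0.
have : `|0 - theta (4 * r)| <= e.
  apply: H; last by rewrite mulr_gt0.
  by rewrite /ball/= sub0r normrN gtr0_norm ?mulr_gt0//; lra.
by rewrite sub0r normrN; apply: le_trans; exact: ler_norm.
Qed.

Lemma phi_le_norm x : phi x <= Phi `|x|.
Proof.
have [x0|x0] := leP x 0; first by rewrite phi_neg// ler0_norm.
rewrite gtr0_norm//; have [x1|x1] := leP x 1; last by rewrite phi_big ?(ltW x1)// Phi_mono//; lra.
have [k /andP[k1 k2]] := xs_bracket _ (introT andP (conj x0 x1)).
have [->|xk] := eqVneq x (xs k); first by rewrite phi_xs Phi_ge0.
have L0 := gaplen_gt0 k; have E := xsS k; have s0 := xs_gt0 k.+1.
have xlt : x < xs k by rewrite lt_neqAle xk.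
rewrite (phi_gap k); last by rewrite k2 ltW.
apply: Phi_mono; have [|_ r1 _ _] := round_tent_bounds ((x - xs k.+1) / gaplen k).
  by rewrite divr_gt0 ?subr_gt0//= ltr_pdivrMr//; rewrite /gaplen; lra.
apply: (le_trans (ler_wpM2l (ltW L0) r1)).
by rewrite mulrC divfK ?gt_eqF//; lra.
Qed.

(** No local formula holds at the accumulation point [0]; the derivative comes from
    [0 <= phi h <= |h| * theta (4 * |h|)]. *)
Lemma is_derive_phi0 : is_derive (0 : R) 1 phi 0.
Proof.
have phi00 : phi 0 = 0 by rewrite phi_neg// oppr0 Phi_le0.
suff fd : h^-1 *: (phi (h *: 1 + 0) - phi 0) @[h --> 0^'] --> (0 : R).
  split; first by apply/cvg_ex; exists 0.
  exact/cvg_lim.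
apply/cvgrPdist_le => /= e e0; have [d d0 dP] := theta_small _ e0.
near=> h; have h0 : h != 0 by near: h; exact: nbhs_dnbhs_neq.
have hd : `|h| < d by near: h; exact: dnbhs0_lt.
rewrite /GRing.scale/= mulr1 addr0 phi00 subr0 sub0r normrN normrM normfV.
have hp : 0 < `|h| by rewrite normr_gt0.
rewrite mulrC ler_pdivrMr// ger0_norm ?phi_ge0//.
apply: (le_trans (phi_le_norm h)); apply: (le_trans (Phi_upper _ hp)).
by rewrite mulrC ler_wpM2r// dP.
Unshelve. all: by end_near.
Qed.

Lemma derive1_phi0 : derive1 phi 0 = 0.
Proof. by rewrite derive1E; have [] := is_derive_phi0. Qed.

(** The alternative [|x| <= r] serves the continuity of the derivative at [0]. *)
Lemma derive1_phi_le x r : 0 < r -> `|x| <= r \/ (exists k, `|x - xs k| <= r) ->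
  `|derive1 phi x| <= theta (4 * r).
Proof.
move=> r0 near_S; have th0 : 0 <= theta (4 * r) by rewrite ltW// theta_pos// mulr_gt0.
have [->|x0] := eqVneq x 0; first by rewrite derive1_phi0 normr0.
have [[k ->]|nk] := pselect (exists k, x = xs k).
  by rewrite (derive1_phi_xs k).2.1 normr0.
have [|_ [t [d [t0 d1 -> tk tx]]]] := phi_regular x x0.
  by move=> k; apply/eqP => xk; apply: nk; exists k.
have tr : t <= r by case: near_S => [|[k]]; apply: le_trans.
rewrite normrM (ger0_norm (g_ge0 t)); apply: (@le_trans _ _ (g t)).
  by rewrite ler_piMr ?g_ge0// ler_norml.
have /andP[_ /le_trans] := g_theta _ t0; apply; apply: theta_mono; lra.
Qed.

Lemma phi_C1 : C1 phi.
Proof.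
split=> x.
  have [->|x0] := eqVneq x 0; first by apply: ex_derive; exact: is_derive_phi0.
  have [[k ->]|nk] := pselect (exists k, x = xs k); first exact: (derive1_phi_xs k).1.
  have [|[U [oU Ux C2]] _] := phi_regular x x0.
    by move=> k; apply/eqP => xk; apply: nk; exists k.
  by have [] := C2 _ Ux.
have [->|x0] := eqVneq x 0.
  apply/cvgrPdist_le => /= e e0; rewrite derive1_phi0.
  have [d d0 dP] := theta_small _ e0.
  have nd : \forall z \near (0 : R), `|z| < d by exact: nbhs0_lt.
  apply: filterS nd => z zd; rewrite sub0r normrN.
  have [->|z0] := eqVneq z 0; first by rewrite derive1_phi0 normr0 ltW.
  have zp : 0 < `|z| by rewrite normr_gt0.
  by apply: (le_trans (derive1_phi_le z `|z| zp _)); [left|exact: dP].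
have [[k ->]|nk] := pselect (exists k, x = xs k); first exact: (derive1_phi_xs k).2.2.
have [|[U [oU Ux C2]] _] := phi_regular x x0.
  by move=> k; apply/eqP => xk; apply: nk; exists k.
by apply: differentiable_continuous; apply/derivable1_diffP; have [] := C2 _ Ux.
Qed.

Lemma derive1_phi_right k s : 0 < s -> s < 3 * xs k -> derive1 phi (xs k + s) = g s.
Proof.
move=> s0 sk; pose U := [set` `]xs k, 4 * xs k[] : set R.
have oU : open U by exact: itv_open.
have phiE y : U y -> phi y = Phi (y - xs k).
  by rewrite /U/= in_itv/= => /andP[y1 y2]; rewrite (phi_right k)// !ltW.
have D1 (y : R) : U y -> is_derive y 1 (fun y => Phi (y - xs k)) (g (y - xs k)).
  move=> _; rewrite -[g _]mulr1; apply: (@is_derive1_comp _ Phi (fun y => y - xs k)).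
  by apply: is_derive_eq; rewrite subr0.
have Us : U (xs k + s) by rewrite /U/= in_itv/=; apply/andP; split; lra.
by rewrite (C1_local _ _ _ _ oU phiE D1 _ Us).2 addrAC subrr add0r.
Qed.

Lemma derive1_phi_neg x : x < 0 -> derive1 phi x = - g (- x).
Proof.
move=> x0.
have phiE y : [set y | y < 0] y -> phi y = Phi (- y).
  by move=> /= y0; rewrite phi_neg// ltW.
have D1 (y : R) : [set y | y < 0] y -> is_derive y 1 (fun y => Phi (- y)) (g (- y) * -1).
  by move=> _; apply: (@is_derive1_comp _ Phi -%R).
by rewrite (C1_local _ _ _ _ (@open_lt R 0) phiE D1 _ x0).2 mulrN1.
Qed.

Lemma modulus_phi k r : 0 < r ->
  theta r <= modulus (derive1 phi) (xs k) r /\ modulus (derive1 phi) (xs k) r <= theta (4 * r).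
Proof.
move=> r0; rewrite /modulus; set E := [set _ | _ in _].
have s0 := xs_gt0 k.
have ub : ubound E (theta (4 * r)).
  move=> _ [x /= xr <-]; rewrite (derive1_phi_xs k).2.1 subr0.
  by apply: derive1_phi_le => //; right; exists k.
split.
  suff [x xr lex] : exists2 x, `|x - xs k| <= r & theta r <= `|derive1 phi x|.
    apply: (le_trans lex); apply: ub_le_sup; first by exists (theta (4 * r)).
    by exists x => //; rewrite (derive1_phi_xs k).2.1 subr0.
  have [rk|rk] := ltP r (3 * xs k).
    exists (xs k + r); first by rewrite addrAC subrr add0r gtr0_norm.
    rewrite derive1_phi_right// ger0_norm ?g_ge0//.
    have /andP[+ _] := g_theta _ r0; apply: le_trans; apply: theta_mono => //; lra.
  (* The point [xs k + r] may now fall in the rounded part or in another gap. To the left of [0]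
     nothing is rounded, and the distance [r - xs k >= 2 / 3 * r] is enough for
     [theta (2 * (r - xs k)) >= theta r]. *)
  exists (xs k - r); first by rewrite addrAC subrr add0r normrN gtr0_norm.
  have rk0 : xs k - r < 0 by lra.
  rewrite derive1_phi_neg// normrN ger0_norm ?g_ge0// opprB.
  have rk1 : 0 < r - xs k by lra.
  have /andP[+ _] := g_theta _ rk1; apply: le_trans; apply: theta_mono => //; lra.
apply: ge_sup => //.
exists `|derive1 phi (xs k) - derive1 phi (xs k)|; exists (xs k) => //=.
by rewrite subrr normr0 ltW.
Qed.

Lemma phi_xs_lower k s : 0 < s -> s < xs k -> s / 2 * theta s <= phi (xs k + s).
Proof.
move=> s0 sk; have -> : phi (xs k + s) = Phi s; last exact: Phi_lower.
have E : xs k + s - xs k = s by ring.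
by rewrite -[in RHS]E; apply: phi_right; apply/andP; split; lra.
Qed.

Lemma closure_xs0 : closure (range xs) 0.
Proof.
move=> B /nbhs_ballP[e /= e0 eB].
pose m := Num.min e 1.
have [|k /andP[k1 k2]] := xs_bracket m.
  by rewrite lt_min e0 ltr01/= ge_min lexx orbT.
exists (xs k.+1); split; first by exists k.+1.
apply: eB; rewrite /ball/= sub0r normrN gtr0_norm ?xs_gt0//.
by apply: (lt_le_trans k1); rewrite ge_min lexx.
Qed.

Lemma phi_C2_on : C2_on phi (~` closure (range xs)).
Proof.
move=> x nx; have x0 : x != 0 by apply/eqP => x0; apply: nx; rewrite x0; exact: closure_xs0.
have [|[U [oU Ux C2]] _] := phi_regular x x0.
  by move=> k; apply/eqP => xk; apply: nx; apply: subset_closure; exists k.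
exact: C2.
Qed.

Lemma xs_inj : injective xs.
Proof.
move=> j k jk; apply/eqP; rewrite eqn_leq; apply/andP; split; rewrite leqNgt; apply/negP => H.
  by have := le_xs _ _ H; have := xsS k; have := xs_gt0 k.+1; lra.
by have := le_xs _ _ H; have := xsS j; have := xs_gt0 j.+1; lra.
Qed.

Lemma infinite_range_xs : infinite_set (range xs).
Proof.
apply/infiniteP; have := inj_card_eq (in2W xs_inj : {in [set: nat] &, injective xs}).
by rewrite card_eq_le => /andP[].
Qed.

Lemma bounded_range_xs : bounded_set (range xs).
Proof.
exists 1; split => // M M1 _ [k _ <-] /=; rewrite gtr0_norm ?xs_gt0//.
by apply: le_trans (ltW M1); rewrite -xs0 le_xs.
Qed.

Lemma countable_range_xs : countable (range xs).
Proof. exact: card_image_le. Qed.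

End construction.

Theorem theorem1p2 (R : realType) (theta : R -> R)
  (theta_pos : forall r : R, 0 < r -> 0 < theta r)
  (theta_mono : forall r s : R, 0 < r -> r <= s -> theta r <= theta s)
  (theta_lim0 : theta r @[r --> 0^'+] --> (0 : R))
  (theta_nondini : integral_diverges_at0 theta) :
  exists (phi : R -> R) (S : set R),
    C1 phi /\
    [/\ bounded_set S, infinite_set S & countable S] /\
    (forall x0 : R, S x0 -> forall r : R, 0 < r ->
       theta r <= modulus (derive1 phi) x0 r /\
       modulus (derive1 phi) x0 r <= theta (4 * r)) /\
    C2_on phi (~` closure S) /\
    (forall (X : R * R)
       (omega : probability (measurableTypeR R * measurableTypeR R)%type R),
       epigraph phi X ->
       is_harmonic_measure (epigraph phi) X omega ->
       [set (x, phi x) | x in S] `<=` zero_density_set (epigraph phi) omega /\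
       infinite_set (zero_density_set (epigraph phi) omega)).
Proof.
have [g [dg [g_le0 g_theta g_C1 cg]]] := smooth_between theta theta_pos theta_mono theta_lim0.
have [Phi Phi_derive Phi_le0] := antiderivative g cg g_le0.
pose f := phi Phi.
have f_C1 : C1 f by exact: (phi_C1 theta g dg Phi).
have f0 x : 0 <= f x by exact: (phi_ge0 theta g Phi).
have fxs k : f (xs k) = 0 by exact: phi_xs.
have cf : continuous f.
  by move=> x; apply: differentiable_continuous; apply/derivable1_diffP; exact: f_C1.1.
have dense X (omega : probability (measurableTypeR R * measurableTypeR R)%type R) :
    epigraph f X -> is_harmonic_measure (epigraph f) X omega ->
    [set (x, f x) | x in range (@xs R)] `<=` zero_density_set (epigraph f) omega.
  move=> DX hm _ [_ [k _ <-] <-]; rewrite fxs.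
  (* The second [xs k] is [delta], the range of the lower bound [phi_xs_lower]. *)
  apply: (zero_density_point f theta (xs k) (xs k) cf f0 theta_pos theta_mono theta_lim0
    theta_nondini (xs_gt0 k) _ (fxs k) X omega DX hm).
  by move=> s s0 sk; exact: (phi_xs_lower theta g).
exists f; exists (range (@xs R)); split; first exact: f_C1.
split; first by split; [exact: bounded_range_xs|exact: infinite_range_xs|exact: countable_range_xs].
split; first by move=> _ [k _ <-] r r0; exact: (modulus_phi theta g dg).
split; first exact: (phi_C2_on g dg).
move=> X omega DX hm; split; first exact: dense DX hm.
move=> fin; apply: infinite_range_xs.
have := finite_image fst (sub_finite_set (dense _ _ DX hm) fin).
by rewrite image_comp; apply: sub_finite_set => _ [k _ <-]; exists (xs k) => //; exists k.
Qed.
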